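(* Let $m\ge 2$ be an integer. The automorphism group of the group $\mathrm{Aut}(R_m)$ is $\mathrm{Aut}^*(R_m)$, in the sense that the action of $\mathrm{Aut}^*(R_m)$ on $\mathrm{Aut}(R_m)$ by conjugation induces an isomorphism from $\mathrm{Aut}^*(R_m)$ onto the full automorphism group of $\mathrm{Aut}(R_m)$.
   Context: Fix an integer $m\ge 2$. An $m$-edge-coloured complete graph is a complete graph each of whose edges is assigned one of the colours $1,\dots,m$. $R_m$ denotes the unique (up to isomorphism) countable $m$-edge-coloured complete graph which is universal (every finite or countable $m$-edge-coloured complete graph embeds in it, colour-preservingly) and homogeneous (every colour-preserving isomorphism between finite induced subgraphs extends to a colour-preserving automorphism of $R_m$). $\mathrm{Aut}(R_m)$ is the group of permutations of the vertex set of $R_m$ preserving the colour of every edge. $\mathrm{Aut}^*(R_m)$ is the group of permutations $g$ of the vertex set of $R_m$ which induce a permutation of the colours, i.e. for which there is a permutation $\pi$ of $\{1,\dots,m\}$ such that for all edges $\{u,v\}$, the colour of $\{u^g,v^g\}$ is $\pi$ applied to the colour of $\{u,v\}$. $\mathrm{Aut}(R_m)$ is a normal subgroup of $\mathrm{Aut}^*(R_m)$. *)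

(* Defs.v *)
From HB Require Import structures.
From mathcomp Require Import all_boot all_fingroup.
From mathcomp Require Import finmap.
From mathcomp Require Import boolp.

Set Implicit Arguments.
Unset Strict Implicit.
Unset Printing Implicit Defensive.

Local Open Scope group_scope.

(* Permutations act on the right, as for [{perm T}] on finite types: [f * g]
   is [f] followed by [g], and [a ^ g = g^-1 * a * g]. *)
Section Permutations.
Variable T : choiceType.

Record permutation := Permutation {
  permutation_fun :> T -> T;
  permutation_bij : `[< bijective permutation_fun >] }.

HB.instance Definition _ := [isSub for permutation_fun].
HB.instance Definition _ := [Choice of permutation by <:].

Implicit Types f g h : permutation.

Lemma permutationP f g : f =1 g -> f = g.
Proof. by move=> fg; apply/val_inj/funext. Qed.

Lemma permutation_inv_sig f :
  {g : T -> T | cancel f g /\ cancel g f}.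
Proof. by apply: cid; case: (asboolP _ (permutation_bij f)) => g; exists g. Qed.

Fact permutation_one_bij : `[< bijective (@id T) >].
Proof. by apply/asboolP; exists id. Qed.
Definition permutation_one := Permutation permutation_one_bij.

Fact permutation_mul_bij f g : `[< bijective (g \o f) >].
Proof.
by apply/asboolP/bij_comp; [apply: (asboolP _ (permutation_bij g))
                           |apply: (asboolP _ (permutation_bij f))].
Qed.
Definition permutation_mul f g := Permutation (permutation_mul_bij f g).

Fact permutation_inv_bij f : `[< bijective (sval (permutation_inv_sig f)) >].
Proof.
by apply/asboolP; case: permutation_inv_sig => g [fK gK]; exists f.
Qed.
Definition permutation_inv f := Permutation (permutation_inv_bij f).

Fact permutation_mulA : associative permutation_mul.
Proof. by move=> f g h; apply: permutationP. Qed.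
Fact permutation_mul1 : left_id permutation_one permutation_mul.
Proof. by move=> f; apply: permutationP. Qed.
Fact permutation_mulr1 : right_id permutation_one permutation_mul.
Proof. by move=> f; apply: permutationP. Qed.
Fact permutation_mulV :
  left_inverse permutation_one permutation_inv permutation_mul.
Proof.
move=> f; apply: permutationP => x /=.
by case: permutation_inv_sig => g [fK gK] /=.
Qed.
Fact permutation_mulrV :
  right_inverse permutation_one permutation_inv permutation_mul.
Proof.
move=> f; apply: permutationP => x /=.
by case: permutation_inv_sig => g [fK gK] /=.
Qed.

HB.instance Definition _ := isGroup.Build permutation permutation_mulA
  permutation_mul1 permutation_mulr1 permutation_mulV permutation_mulrV.

Lemma permutation1E x : (1 : permutation) x = x. Proof. by []. Qed.
Lemma permutationME f g x : (f * g) x = g (f x). Proof. by []. Qed.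
Lemma permutationKV f x : f (f^-1 x) = x.
Proof. by rewrite -permutationME mulVg. Qed.
Lemma permutationK f x : f^-1 (f x) = x.
Proof. by rewrite -permutationME mulgV. Qed.

End Permutations.

Section GroupAutomorphisms.
Variable G : groupType.

Definition group_aut_pred : {pred permutation G} :=
  fun f => `[< {morph f : x y / x * y} >].

Fact group_aut_closed : group_closed group_aut_pred.
Proof.
split; first by apply/asboolP.
move=> f g /asboolP fM /asboolP gM; apply/asboolP => x y.
rewrite !permutationME; apply: (can_inj (permutationK g)).
by rewrite gM !permutationKV fM.
Qed.

Record group_aut := GroupAut {
  group_aut_val :> permutation G;
  group_autP : group_aut_val \in group_aut_pred }.

HB.instance Definition _ := [isSub for group_aut_val].
HB.instance Definition _ := [Choice of group_aut by <:].
HB.instance Definition _ :=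
  SubChoice_isSubGroup.Build _ _ group_aut group_aut_closed.

End GroupAutomorphisms.

(* The edges are the pairs of distinct vertices and the colours are the
   elements of ['I_m]. The values [colour u u] are irrelevant: nothing below
   depends on them. A [countType] may be finite. *)
Record ecgraph (m : nat) := ECGraph {
  vertex :> countType;
  colour : vertex -> vertex -> 'I_m;
  colour_sym : forall u v : vertex, u != v -> colour u v = colour v u }.

Section ColouredGraphs.
Variable m : nat.
Implicit Types G H R : ecgraph m.

Definition colour_preserving G H (f : G -> H) :=
  forall u v : G, u != v -> colour (f u) (f v) = colour u v.

Definition ec_embedding G H (f : G -> H) :=
  injective f /\ colour_preserving f.

Definition ec_isomorphism G H (f : G -> H) :=
  bijective f /\ colour_preserving f.

Section Induced.
Variables (G : ecgraph m) (A : {fset G}).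

Fact induced_colour_sym (u v : A) :
  u != v -> colour (val u) (val v) = colour (val v) (val u).
Proof. exact: colour_sym. Qed.

Definition induced : ecgraph m := ECGraph induced_colour_sym.
End Induced.

Definition universal R :=
  forall G : ecgraph m, exists f : G -> R, ec_embedding f.

Definition homogeneous R :=
  forall (A B : {fset R}) (f : induced A -> induced B), ec_isomorphism f ->
  exists2 g : R -> R, ec_isomorphism g & forall x : A, g (val x) = val (f x).

Definition aut_pred R : {pred permutation R} :=
  fun g => `[< colour_preserving g >].

Definition aut_star_pred R : {pred permutation R} :=
  fun g => `[< exists pi : 'S_m,
    forall u v : R, u != v -> colour (g u) (g v) = pi (colour u v) >].

End ColouredGraphs.

Section AutomorphismGroups.
Variables (m : nat) (R : ecgraph m).

Let permutation_neq (g : permutation R) (u v : R) : u != v -> g u != g v.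
Proof. by rewrite (inj_eq (can_inj (permutationK g))). Qed.

Fact aut_closed : group_closed (aut_pred (R := R)).
Proof.
split; first by apply/asboolP.
move=> f g /asboolP fP /asboolP gP; apply/asboolP => u v uv.
have := gP _ _ (permutation_neq (f * g^-1) uv).
by rewrite !permutationME !permutationKV fP // => ->.
Qed.

Fact aut_star_closed : group_closed (aut_star_pred (R := R)).
Proof.
split; first by apply/asboolP; exists 1 => u v _; rewrite perm1.
move=> f g /asboolP[p fP] /asboolP[q gP]; apply/asboolP; exists (p * q^-1).
move=> u v uv; have := gP _ _ (permutation_neq (f * g^-1) uv).
by rewrite permM !permutationME !permutationKV fP // => ->; rewrite permK.
Qed.

Record Aut_ec := AutEC {
  aut_val :> permutation R;
  autP : aut_val \in aut_pred (R := R) }.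

HB.instance Definition _ := [isSub for aut_val].
HB.instance Definition _ := [Choice of Aut_ec by <:].
HB.instance Definition _ := SubChoice_isSubGroup.Build _ _ Aut_ec aut_closed.

Record Aut_star := AutStar {
  aut_star_val :> permutation R;
  aut_starP : aut_star_val \in aut_star_pred (R := R) }.

HB.instance Definition _ := [isSub for aut_star_val].
HB.instance Definition _ := [Choice of Aut_star by <:].
HB.instance Definition _ :=
  SubChoice_isSubGroup.Build _ _ Aut_star aut_star_closed.

End AutomorphismGroups.

(* Main.v *)
Require Import Defs.
From HB Require Import structures.
From mathcomp Require Import all_boot all_fingroup.
From mathcomp Require Import finmap.
From mathcomp Require Import boolp.

(* The only hard point is surjectivity: an automorphism [f] of the group
   [G = Aut R] must permute the point stabilisers [G_x], for then it is the
   conjugation by a permutation of the vertices, which preserves the partition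
   of the pairs into colours because colours are orbits of [G].

   Call [t] in [G] a pointed involution at [x] if it fixes [x] only and all its
   2-cycles have a given colour [c0]. By back and forth, those at [x] are all
   conjugate in [G], and any two of them, [t] and [t'], are joined by a path
   [t - k1 - k - k' - t'] of consecutively commuting ones: [k1] is chosen
   generically, then [k] and [k'] are built simultaneously. Hence [h] fixes [x]
   iff such a path of conjugates of [t] joins [t] to [t ^ h]. This describes
   [G_x] by an existential formula of group theory, so that [f(G_x)] is an
   analytic subgroup of [G]; it has the property of Baire and countable index,
   hence it is open.

   An open subgroup [H] has a least finite support [A], and [H] preserves [A].
   If [A] had several points, finitely many conjugates of [H] by elements
   outside [H] would have their intersection inside [H]; the [G_x] do not have
   this property, so [A] is a point [y], and [f(G_x) = G_y]. *)

Set Implicit Arguments.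
Unset Strict Implicit.
Unset Printing Implicit Defensive.

Local Open Scope group_scope.

(** * Constructions by stages *)

(** [S] is an invariant, [le] relates consecutive stages, and [D n] is the task met in passing from
    stage [n] to stage [n.+1]. *)
Lemma dependent_chain (P : Type) (S : P -> Prop) (le : P -> P -> Prop)
    (D : nat -> P -> Prop) (p0 : P) :
  S p0 -> (forall n p, S p -> exists q, [/\ S q, le p q & D n q]) ->
  exists f : nat -> P, [/\ f 0 = p0, forall n, S (f n),
    forall n, le (f n) (f n.+1) & forall n, D n (f n.+1)].
Proof.
move=> S0 step.
have /choice[F FP] : forall np : nat * {p | S p}, exists q : {p | S p},
    le (sval np.2) (sval q) /\ D np.1 (sval q).
  move=> [n [p Sp]] /=; have [q [Sq lq Dq]] := step n p Sp.
  by exists (exist _ q Sq).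
pose f := fix f n := if n is n'.+1 then F (n', f n') else exist _ p0 S0.
exists (fun n => sval (f n)); split=> // n; first exact: (svalP (f n)).
- by case: (FP (n, f n)).
- by case: (FP (n, f n)).
Qed.

Lemma choice_in (T : eqType) (U : Type) (s : seq T) (P : T -> U -> Prop) :
  U -> (forall x, x \in s -> exists y, P x y) ->
  exists f, forall x, x \in s -> P x (f x).
Proof.
move=> u0 sP; have /choice[f fP] : forall x, exists y, x \in s -> P x y.
  move=> x; case: (boolP (x \in s)) => [/sP[y]|_]; first by exists y.
  by exists u0.
by exists f.
Qed.

(** * The one-point extension property *)

Section Graph.
Variables (m : nat) (R : ecgraph m).
Implicit Types (u v w x y z : R) (p q : seq (R * R)) (s : seq R).
Notation G := (Aut_ec R).
Implicit Types a b g h t k : G.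

(** Universality and homogeneity enter the proof through this property only. *)
Definition extension_property :=
  forall s (f : R -> 'I_m), exists2 w, w \notin s &
    {in s, forall u, colour w u = f u}.

(** Universality embeds [A] together with an extra vertex [None] having the prescribed colours.
    Homogeneity, applied to [A] and its copy [B], gives an automorphism [g], and the preimage under
    [g] of the extra vertex is the wanted one. *)
Lemma universal_homogeneous_extension (c0 : 'I_m) :
  universal R -> homogeneous R -> extension_property.
Proof.
move=> univ hom s f; pose A := [fset u in s]%fset.
pose col (a b : option A) := match a, b with
  | Some u, Some v => colour (val u) (val v)
  | Some u, None | None, Some u => f (val u)
  | None, None => c0
  end.
have colC (a b : option A) : a != b -> col a b = col b a.
  case: a b => [u|] [v|] //= uv; apply: colour_sym.
  by apply: contra uv => /eqP/val_inj->.
have [e [e_inj eP]] := univ (ECGraph colC).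
pose B := [fset v in [seq e (Some i) | i <- enum {: A}]]%fset.
have eB (u : A) : e (Some u) \in B by rewrite inE; apply: map_f; rewrite mem_enum.
pose F (u : A) : B := FSetSub (eB u).
have /choice[F' FK] : forall v : B, exists u : A, F u = v.
  move=> v; have := valP v; rewrite inE => /mapP[u _ uv].
  by exists u; apply: val_inj; rewrite /= -uv.
have F_inj : injective F by move=> u v /(congr1 val)/= /e_inj[].
have F_iso : @ec_isomorphism _ (induced A) (induced B) F.
  split; first by exists F' => // u; apply: F_inj; rewrite FK.
  by move=> u v uv; apply: eP; apply: contra uv => /eqP[->].
have [g [[g' gK g'K] gP] gF] := hom A B F F_iso.
have vN : g' (e None) \notin s.
  apply/negP => vs; have vA : g' (e None) \in A by rewrite !inE.
  have := gF (FSetSub vA); rewrite /= g'K => /e_inj.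
  by [].
exists (g' (e None)) => // u us; have uA : u \in A by rewrite !inE.
rewrite -gP; last by apply: contraNneq vN => ->.
by rewrite g'K; have := gF (FSetSub uA) => /= ->; rewrite eP.
Qed.

Lemma aut_colour g u v : u != v -> colour (g u) (g v) = colour u v.
Proof. by move=> uv; move: (autP g) => /asboolP; apply. Qed.

Lemma aut_inj g : injective g.
Proof. exact: (can_inj (permutationK _)). Qed.

Lemma aut_eq g h : g =1 h -> g = h.
Proof. by move=> gh; apply/val_inj/permutationP. Qed.

Lemma autM g h u : (g * h) u = h (g u). Proof. by []. Qed.
Lemma autKV g : cancel g^-1 g. Proof. exact: permutationKV. Qed.
Lemma autK g : cancel g g^-1. Proof. exact: permutationK. Qed.
Lemma autJ g h u : (g ^ h) u = h (g (h^-1 u)). Proof. by []. Qed.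

End Graph.

(** * Finite partial isomorphisms *)

Section PartialIsomorphisms.
Variables (m : nat) (R : ecgraph m).
Implicit Types (u v w x y z : R) (p q : seq (R * R)) (s : seq R).
Implicit Types (e f : R * R).
Notation G := (Aut_ec R).
Implicit Types a b g h t k : G.

(** A finite partial map is the list of its pairs. Being injective, single-valued and
    colour-preserving is a condition on two pairs at a time, and so passes to unions of chains. *)
Definition compat e f :=
  (e.1 == f.1) = (e.2 == f.2) /\ (e.1 != f.1 -> colour e.2 f.2 = colour e.1 f.1).

Definition partial_iso p := {in p &, forall e f, compat e f}.

Definition flip p := [seq (e.2, e.1) | e <- p].

Definition lookup p u := (nth (u, u) p (index u (unzip1 p))).2.

Lemma compat_refl e : compat e e.
Proof. by split=> [|/negP[]]; rewrite ?eqxx. Qed.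

Lemma compat_sym e f : compat e f -> compat f e.
Proof.
case=> E C; split=> [|fe]; first by rewrite ![f.1 == _]eq_sym ![f.2 == _]eq_sym.
have ef : e.1 != f.1 by rewrite eq_sym.
by rewrite colour_sym ?C // 1?colour_sym // eq_sym -E.
Qed.

Lemma compat_flip e f : compat e f -> compat (e.2, e.1) (f.2, f.1).
Proof. by case=> E C; split=> //= ef; rewrite C // E. Qed.

Lemma compat_act g h e f : compat e f -> compat (g e.1, h e.2) (g f.1, h f.2).
Proof.
case=> E C; split=> /=; rewrite !(inj_eq (@aut_inj _ _ _)) // => ef.
by rewrite !aut_colour ?C // -E.
Qed.

Lemma compat_id u v : compat (u, u) (v, v).
Proof. by split. Qed.

Lemma compat_neq u v u' v' : u != u' -> v != v' -> colour v v' = colour u u' ->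
  compat (u, v) (u', v').
Proof. by move=> uu' vv' C; split=> //=; rewrite (negPf uu') (negPf vv'). Qed.

Lemma mem_flip p u v : ((u, v) \in flip p) = ((v, u) \in p).
Proof.
apply/mapP/idP=> [[[u1 v1] ? [-> ->]] //|vu].
by exists (v, u).
Qed.

Lemma mem_dom p u v : (u, v) \in p -> u \in unzip1 p.
Proof. by move=> uv; apply/mapP; exists (u, v). Qed.

Lemma mem_rng p u v : (u, v) \in p -> v \in unzip2 p.
Proof. by move=> uv; apply/mapP; exists (u, v). Qed.

Lemma mem_domP p u : reflect (exists v, (u, v) \in p) (u \in unzip1 p).
Proof.
apply: (iffP idP) => [/mapP[[u1 v] ? ->]|[v /mem_dom//]]; by exists v.
Qed.

Lemma mem_rngP p v : reflect (exists u, (u, v) \in p) (v \in unzip2 p).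
Proof.
apply: (iffP idP) => [/mapP[[u v1] ? ->]|[u /mem_rng//]]; by exists u.
Qed.

Lemma unzip1_flip p : unzip1 (flip p) = unzip2 p.
Proof. by rewrite /unzip1 /unzip2 -map_comp. Qed.

Lemma unzip2_flip p : unzip2 (flip p) = unzip1 p.
Proof. by rewrite /unzip1 /unzip2 -map_comp. Qed.

Lemma lookupP p u : u \in unzip1 p -> (u, lookup p u) \in p.
Proof.
move=> up; have ip : (index u (unzip1 p) < size p)%N.
  by rewrite -(size_map fst) index_mem.
rewrite /lookup; set e := nth _ _ _; have -> : (u, e.2) = e; last exact: mem_nth.
by rewrite [RHS]surjective_pairing -{1}(nth_index u up) (nth_map (u, u)).
Qed.

Lemma partial_iso_inj p u v v' : partial_iso p ->
  (u, v) \in p -> (u, v') \in p -> v = v'.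
Proof. by move=> pi e f; have [/=] := pi _ _ e f; rewrite eqxx => /esym/eqP. Qed.

Lemma lookupE p u v : partial_iso p -> (u, v) \in p -> lookup p u = v.
Proof.
by move=> pi uv; apply: partial_iso_inj pi (lookupP (mem_dom uv)) uv.
Qed.

Lemma partial_iso_flip p : partial_iso p -> partial_iso (flip p).
Proof.
move=> pi _ _ /mapP[e ep ->] /mapP[f fp ->]; apply: compat_flip.
exact: pi.
Qed.

Lemma partial_iso_cons p e : partial_iso p ->
  {in p, forall f, compat e f} -> partial_iso (e :: p).
Proof.
move=> pi ep f g; rewrite !inE => /predU1P[->|fp] /predU1P[->|gp] //.
- exact: compat_refl.
- exact: ep.
- by apply: compat_sym; apply: ep.
- exact: pi.
Qed.

Lemma partial_iso_cat p q : partial_iso p -> partial_iso q ->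
  {in p & q, forall e f, compat e f} -> partial_iso (p ++ q).
Proof.
move=> pi qi pq f g; rewrite !mem_cat => /orP[fp|fq] /orP[gp|gq].
- exact: pi.
- exact: pq.
- by apply: compat_sym; apply: pq.
- exact: qi.
Qed.

Lemma chain_subset (F : nat -> seq (R * R)) :
  (forall n, {subset F n <= F n.+1}) ->
  forall i j, (i <= j)%N -> {subset F i <= F j}.
Proof.
move=> mono i j /subnK<-; elim: (j - i)%N => [//|d IH] e /IH; exact: mono.
Qed.

(** Any two pairs of the union occur in a common stage, so the union is a partial isomorphism;
    exhausting domain and range makes it bijective. *)
Lemma partial_iso_limit (F : nat -> seq (R * R)) :
  (forall n, partial_iso (F n)) -> (forall n, {subset F n <= F n.+1}) ->
  (forall v, exists n, v \in unzip1 (F n)) ->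
  (forall v, exists n, v \in unzip2 (F n)) ->
  exists a : G, (forall n e, e \in F n -> a e.1 = e.2) /\
    forall v, exists n, (v, a v) \in F n.
Proof.
move=> piF mono dom rng.
have pair i j e f : e \in F i -> f \in F j -> compat e f.
  move=> ei fj; apply: (piF (maxn i j)).
    exact: (chain_subset mono (leq_maxl i j)).
  exact: (chain_subset mono (leq_maxr i j)).
have /choice[F1 F1P] : forall v, exists w, exists n, (v, w) \in F n.
  by move=> v; have [n /mem_domP[w ?]] := dom v; exists w, n.
have /choice[F2 F2P] : forall v, exists w, exists n, (w, v) \in F n.
  by move=> v; have [n /mem_rngP[w ?]] := rng v; exists w, n.
have F1K : cancel F1 F2.
  move=> v; have [i vi] := F1P v; have [j vj] := F2P (F1 v).
  by have [/= + _] := pair _ _ _ _ vj vi; rewrite eqxx => /eqP.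
have F2K : cancel F2 F1.
  move=> v; have [i vi] := F1P (F2 v); have [j vj] := F2P v.
  by have [/= + _] := pair _ _ _ _ vi vj; rewrite eqxx => /esym/eqP.
have bijF : `[< bijective F1 >] by apply/asboolP; exists F2.
have autF : Permutation bijF \in aut_pred (R := R).
  apply/asboolP => u v uv; have [i ui] := F1P u; have [j vj] := F1P v.
  by have [_] := pair _ _ _ _ ui vj; apply.
exists (AutEC autF); split=> [n [v w] vw|v]; last exact: F1P.
have [i vi] := F1P v.
by have [/= + _] := pair _ _ _ _ vi vw; rewrite eqxx => /esym/eqP.
Qed.

End PartialIsomorphisms.

(** * Back and forth between two involutions *)

Section BackAndForth.
Variables (m : nat) (R : ecgraph m) (c0 : 'I_m).
Hypothesis EP : extension_property R.
Implicit Types (u v w x y z : R) (p q : seq (R * R)) (s : seq R).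
Implicit Types (e f : R * R).
Notation G := (Aut_ec R).
Implicit Types a b g h t k : G.

Definition equivariant t t' p := {in p, forall e, (t e.1, t' e.2) \in p}.

(* Outside [p], the involutions [t] and [t'] look alike: either both are fixed
   point free there, all their 2-cycles having colour [c0], or both are
   trivial. *)
Definition alike t t' p := forall v w, v \notin unzip1 p -> w \notin unzip2 p ->
  [/\ (t v == v) = (t' w == w), t v != v -> colour v (t v) = c0
    & t' w != w -> colour w (t' w) = c0].

Lemma equivariant_flip t t' p : equivariant t t' p -> equivariant t' t (flip p).
Proof. by move=> pt _ /mapP[e ep ->]; rewrite mem_flip; apply: pt. Qed.

Lemma alike_flip t t' p : alike t t' p -> alike t' t (flip p).
Proof.
move=> al v w; rewrite unzip1_flip unzip2_flip => vp wp.
by have [E C C'] := al _ _ wp vp; split.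
Qed.

(** A fresh [w] with the colours transported from [v] is an image for [v], and equivariance forces
    [t v] to go to [t' w]. The second pair is compatible with [p] by applying [t] and [t']; the two
    new pairs are compatible with each other thanks to [alike]. *)
Lemma equivariant_step t t' p0 p v : involutive t -> involutive t' ->
  alike t t' p0 -> {subset p0 <= p} -> partial_iso p -> equivariant t t' p ->
  exists q, [/\ partial_iso q, equivariant t t' q, {subset p <= q}
    & v \in unzip1 q].
Proof.
move=> tK t'K al p0p pi pt; have [vp|vp] := boolP (v \in unzip1 p).
  by exists p; split.
have [w wp wP] := EP (unzip2 p) (fun u => colour v (lookup (flip p) u)).
have vp0 : v \notin unzip1 p0.
  by apply: contra vp => /mem_domP[u /p0p/mem_dom].
have wp0 : w \notin unzip2 p0.
  by apply: contra wp => /mem_rngP[u /p0p/mem_rng].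
have [E C C'] := al v w vp0 wp0.
have vw e : e \in p -> compat (v, w) e.
  case: e => u u' uu'; apply: compat_neq.
  - by apply: contraNneq vp => ->; apply: mem_dom uu'.
  - by apply: contraNneq wp => ->; apply: mem_rng uu'.
  - rewrite wP ?(mem_rng uu') // (lookupE (v := u)) ?mem_flip //.
    exact: partial_iso_flip.
have tvw e : e \in p -> compat (t v, t' w) e.
  by move=> /pt/vw/(compat_act t t'); rewrite /= tK t'K; case: e.
exists [:: (v, w), (t v, t' w) & p]; split.
- apply: partial_iso_cons; first exact: partial_iso_cons.
  move=> e; rewrite inE => /predU1P[->|/vw//]; split=> /=.
    by rewrite ![v == _]eq_sym ![w == _]eq_sym.
  by rewrite eq_sym => tv; rewrite C // C' // -E.
- move=> e; rewrite !inE => /or3P[/eqP->|/eqP->|/pt->]; rewrite ?orbT //=.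
    by rewrite eqxx orbT.
  by rewrite tK t'K eqxx.
- by move=> e ep; rewrite !inE ep !orbT.
- by rewrite inE eqxx.
Qed.

Lemma equivariant_extension t t' p0 : involutive t -> involutive t' ->
  alike t t' p0 -> partial_iso p0 -> equivariant t t' p0 ->
  exists2 a : G, {in p0, forall e, a e.1 = e.2} & forall v, a (t v) = t' (a v).
Proof.
move=> tK t'K al pi0 pt0.
pose S p := [/\ partial_iso p, equivariant t t' p & {subset p0 <= p}].
pose D (n : nat) p := forall v, choice.unpickle n = Some v -> v \in unzip1 p /\ v \in unzip2 p.
have S0 : S p0 by split.
have step (n : nat) p : S p -> exists q, [/\ S q, {subset p <= q} & D n q].
  case=> pi pt p0p; case En : (choice.unpickle n) => [v|]; last first.
    by exists p; split=> // v; rewrite En.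
  have [q [qi qt pq vq]] := equivariant_step v tK t'K al p0p pi pt.
  (* The back step is the same lemma for the inverse map, with [t] and [t'] exchanged. *)
  have p0q : {subset flip p0 <= flip q}.
    by move=> [y z]; rewrite !mem_flip => /p0p/pq.
  have [r [ri rt qr vr]] := equivariant_step v t'K tK (alike_flip al) p0q
    (partial_iso_flip qi) (equivariant_flip qt).
  have qr' : {subset q <= flip r} by case=> y z yz; rewrite mem_flip qr ?mem_flip.
  exists (flip r); split=> [|e /pq/qr' //|u]; first split.
  - exact: partial_iso_flip.
  - exact: equivariant_flip.
  - by move=> e /p0p/pq/qr'.
  rewrite En => -[<-]; rewrite unzip2_flip vr unzip1_flip; split=> //.
  by have /mem_domP[y /qr'] := vq; rewrite mem_flip => /mem_rng.
have [F [F0 FS Fmono FD]] := dependent_chain S0 step.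
have [|//|v|v|a [aP aF]] := @partial_iso_limit _ _ F.
- by move=> n; case: (FS n).
- by exists (choice.pickle v).+1; have [] := FD _ _ (choice.pickleK v).
- by exists (choice.pickle v).+1; have [] := FD _ _ (choice.pickleK v).
exists a => [e ep0|v]; first by apply: (aP 0); rewrite F0.
by have [n /(let: And3 _ H _ := FS n in H)/aP] := aF v.
Qed.

(** Taking both involutions trivial recovers homogeneity in terms of lists of pairs. *)
Lemma homogeneous_list p : partial_iso p ->
  exists a : G, {in p, forall e, a e.1 = e.2}.
Proof.
move=> pi; have al : alike 1 1 p.
  by move=> v w _ _; rewrite !permutation1E !eqxx.
have eq1 : equivariant 1 1 p by case.
have [//|//|a aP _] := equivariant_extension _ _ al pi eq1.
by exists a.
Qed.

End BackAndForth.

(** * Pointed involutions and their finite approximations *)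

Section PointedInvolutions.
Variables (m : nat) (R : ecgraph m) (c0 : 'I_m).
Hypothesis EP : extension_property R.
Implicit Types (u v w x y z : R) (p q : seq (R * R)) (s : seq R).
Implicit Types (e f : R * R).
Notation G := (Aut_ec R).
Implicit Types a b g h t k : G.

Definition pointed_involution x t := [/\ involutive t, t x = x
  & forall v, v != x -> t v != v /\ colour v (t v) = c0].

(* Weak enough for the identity, so that the construction of an involution
   commuting with [t] also yields a first pointed involution. *)
Definition weak_involution x t := [/\ involutive t, t x = x,
  forall v w, v != x -> w != x -> (t v == v) = (t w == w)
  & forall v, t v != v -> colour v (t v) = c0].

Lemma pointed_weak x t : pointed_involution x t -> weak_involution x t.
Proof.
case=> tK tx tP; split=> // v => [w vx wx|tv].
  by rewrite !(negPf (proj1 (tP _ _))).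
by case: (eqVneq v x) tv => [->|/tP[]//]; rewrite tx eqxx.
Qed.

Lemma weak_involution1 x : weak_involution x 1.
Proof. by split=> // [v w|v]; rewrite permutation1E ?eqxx // permutation1E eqxx. Qed.

(* The finite approximations of the pointed involutions fixing [x] and
   commuting with [t]. *)
Definition approx x t p := [/\ partial_iso p, (x, x) \in p,
  forall u v, (u, v) \in p -> (v, u) \in p, equivariant t t p
  & forall u v, (u, v) \in p -> u != x -> u != v /\ colour u v = c0].

Lemma approx0 x t : t x = x -> approx x t [:: (x, x)].
Proof.
move=> tx; split=> [e f|||e|u v].
- by rewrite !inE => /eqP-> /eqP->; apply: compat_refl.
- by rewrite inE.
- by move=> u v; rewrite !inE => /eqP[-> ->].
- by rewrite !inE => /eqP-> /=; rewrite tx.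
- by rewrite inE => /eqP[-> ->]; rewrite eqxx.
Qed.

Lemma approx_rng x t p : approx x t p -> unzip2 p =i unzip1 p.
Proof.
case=> _ _ sw _ _ u; apply/mem_rngP/mem_domP => -[v /sw uv]; by exists v.
Qed.

Lemma approx_dom x t p v : involutive t -> approx x t p ->
  (t v \in unzip1 p) = (v \in unzip1 p).
Proof.
move=> tK [_ _ _ pt _]; apply/mem_domP/mem_domP=> -[w /pt/=]; last by exists (t w).
by rewrite tK; exists (t w).
Qed.

(** The approximations are closed under reversal, so exhausting the domains also exhausts the
    ranges. *)
Lemma approx_limit x t (F : nat -> seq (R * R)) :
  (forall n, approx x t (F n)) -> (forall n, {subset F n <= F n.+1}) ->
  (forall v, exists n, v \in unzip1 (F n)) ->
  exists k : G, [/\ pointed_involution x k, forall v, k (t v) = t (k v),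
    forall n e, e \in F n -> k e.1 = e.2 & forall v, exists n, (v, k v) \in F n].
Proof.
move=> FA mono dom.
have [|//|//|v|k [kP kF]] := @partial_iso_limit _ _ F.
- by move=> n; case: (FA n).
- by have [n vn] := dom v; exists n; rewrite (approx_rng (FA n)).
exists k; split=> //; first split.
- move=> v; have [n vn] := kF v; have [_ _ sw _ _] := FA n.
  by have := kP _ _ (sw _ _ vn).
- by have [_ xx _ _ _] := FA 0; apply: kP xx.
- move=> v vx; have [n vn] := kF v; have [_ _ _ _ nc] := FA n.
  by have [] := nc _ _ vn vx; rewrite eq_sym.
- move=> v; have [n vn] := kF v; have [_ _ _ pt _] := FA n.
  exact: kP (pt _ vn).
Qed.

(** The fresh [w] gets the colours that [p] transports from [v], and [c0] towards [v], [t v] and the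
    points of [s] off the domain. The control over [s] serves to impose genericity later. *)
Lemma approx_add x t p v s : weak_involution x t -> approx x t p ->
  v \notin unzip1 p ->
  exists w q, [/\ w \notin s, approx x t q, {subset p <= q}, (v, w) \in q
    & {in s, forall u, u \notin unzip1 p -> colour w u = c0}].
Proof.
move=> [tK tx tt tc] pA vp; have [pi xp sw pt nc] := pA.
have [w] := EP ([:: v, t v & s] ++ unzip1 p)
  (fun u => if u \in unzip1 p then colour v (lookup p u) else c0).
rewrite mem_cat !inE !negb_or -!andbA => /and4P[wv wtv ws wp] wP.
have tvp : t v \notin unzip1 p by rewrite (approx_dom _ tK pA).
have xd : x \in unzip1 p by apply: mem_dom xp.
have vx : v != x by apply: contraNneq vp => ->.
have wx : w != x by apply: contraNneq wp => ->.
have cwv : colour w v = c0 by rewrite wP ?mem_cat ?inE ?eqxx // (negPf vp).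
have cvw : colour v w = c0 by rewrite colour_sym // eq_sym.
have cwtv : colour w (t v) = c0.
  by rewrite wP ?mem_cat ?inE ?eqxx ?orbT // (negPf tvp).
have ctvw : colour (t v) w = c0 by rewrite colour_sym // eq_sym.
have vtw : v != t w by apply: contra wtv => /eqP->; rewrite tK.
have cvtw : colour v (t w) = c0 by rewrite -(aut_colour t) // tK.
have vw e : e \in p -> compat (v, w) e.
  case: e => u u' uu'; have u'p : u' \in unzip1 p := mem_dom (sw _ _ uu').
  apply: compat_neq.
  - by apply: contraNneq vp => ->; apply: mem_dom uu'.
  - by apply: contraNneq wp => ->.
  - by rewrite wP ?mem_cat ?u'p ?orbT // (lookupE (v := u)) //; apply: sw.
have wv_ e : e \in p -> compat (w, v) e.
  by case: e => u u' /sw/vw/compat_flip.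
have act_ u u' : {in p, forall e, compat (u, u') e} ->
    {in p, forall e, compat (t u, t u') e}.
  by move=> H e /pt/H/(compat_act t t); rewrite /= !tK; case: e.
(* [q0] is the closure of [(v, w)] under reversal and under [t]. Compatibility of [(v, w)] with the
   three other pairs yields the remaining cases by these two operations. *)
pose q0 := [:: (v, w); (w, v); (t v, t w); (t w, t v)].
have c1 : compat (v, w) (w, v).
  by apply: compat_neq; rewrite // 1?eq_sym // cwv.
have c2 : compat (v, w) (t v, t w).
  split=> /=; first by rewrite ![_ == t _]eq_sym; apply: tt.
  by rewrite eq_sym => tv; rewrite !tc // (tt w v).
have c3 : compat (v, w) (t w, t v).
  by apply: compat_neq; rewrite // cwtv.
have q0i : partial_iso q0.
  do 3?[apply: partial_iso_cons]; rewrite /q0.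
  - apply: partial_iso_cons; first by case.
    by [].
  - move=> e; rewrite inE => /eqP->.
    by have /= := compat_act t t c1.
  - move=> e; rewrite !inE => /orP[]/eqP->; first exact: compat_flip c3.
    exact: compat_flip c2.
  - by move=> e; rewrite !inE => /or3P[]/eqP->.
exists w, (q0 ++ p); split=> //.
- split.
  + apply: partial_iso_cat => // e f; rewrite !inE => /or4P[]/eqP-> fp.
    * exact: vw. * exact: wv_. * exact: (act_ _ _ vw). * exact: (act_ _ _ wv_).
  + by rewrite mem_cat xp orbT.
  + move=> u u'; rewrite !mem_cat => /orP[|/sw->]; last by rewrite orbT.
    by rewrite !inE => /or4P[]/eqP[-> ->]; rewrite eqxx ?orbT.
  + move=> e; rewrite !mem_cat => /orP[|/pt->]; last by rewrite orbT.
    by rewrite !inE => /or4P[]/eqP->; rewrite /= ?tK eqxx ?orbT.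
  + move=> u u'; rewrite mem_cat => /orP[|/nc//].
    have vtw' : t v != t w by rewrite (inj_eq (@aut_inj _ _ _)) eq_sym.
    by rewrite !inE => /or4P[]/eqP[-> ->] _; rewrite ?aut_colour // 1?eq_sym //;
      split=> //; rewrite // eq_sym.
- by move=> e ep; rewrite mem_cat ep orbT.
- by rewrite !inE eqxx.
- by move=> u us up; rewrite wP ?mem_cat ?inE ?us ?orbT // (negPf up).
Qed.

(* Fresh points [w] can be chosen such that the colours which [t] and [t']
   determine between [w], [t w] and [t' w] do not conflict with each other. *)
Definition generic_pair t t' := forall s (f : R -> 'I_m), exists w,
  [/\ w \notin s, {in s, forall u, colour w u = f u}, t' (t w) != w
    & colour w (t' (t w)) = c0].

(** The same [w] serves: applying [t] and then [t'] maps the pair [w], [t (t' w)] to the pair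
    [t' (t w)], [w]. *)
Lemma generic_pairC t t' : involutive t -> involutive t' ->
  generic_pair t t' -> generic_pair t' t.
Proof.
move=> tK t'K tt' s f; have [w [ws wf ww cw]] := tt' s f.
have ww' : t (t' w) != w.
  by apply: contra ww => /eqP tt'w; rewrite -{1}tt'w tK t'K.
exists w; split=> //; rewrite eq_sym in ww'.
have -> : colour w (t (t' w)) = colour (t w) (t' w).
  by rewrite -(aut_colour t ww') tK.
have tt'w : t w != t' w by apply: contra ww => /eqP->; rewrite t'K.
by rewrite -(aut_colour t' tt'w) t'K colour_sym.
Qed.

End PointedInvolutions.

(** * Generic commuting involutions and fresh blocks *)

Section CommutingInvolutions.
Variables (m : nat) (R : ecgraph m) (c0 : 'I_m).
Hypothesis EP : extension_property R.
Implicit Types (u v w x y z : R) (p q : seq (R * R)) (s : seq R).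
Implicit Types (e f : R * R).
Notation G := (Aut_ec R).
Implicit Types a b g h t k : G.
Local Notation pointed_involution := (@pointed_involution m R c0).
Local Notation weak_involution := (@weak_involution m R c0).
Local Notation approx := (@approx m R c0).
Local Notation generic_pair := (@generic_pair m R c0).

Lemma generic_commuting_involution x t t' :
  weak_involution x t -> involutive t' -> exists k : G,
  [/\ pointed_involution x k, forall v, k (t v) = t (k v) & generic_pair k t'].
Proof.
move=> tw t'K; have [tK tx _ _] := tw.
(* A task is a vertex to be put into the domain, or an instance of genericity; the colours of the
   latter are listed along [s] because the tasks have to be countable. *)
pose task := (R + seq R * seq 'I_m)%type.
pose D (n : nat) p := match choice.unpickle n : option task return Prop with
  | None => True
  | Some (inl v) => v \in unzip1 p
  | Some (inr (s, l)) => exists w w1, [/\ (w, w1) \in p, w \notin s,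
      {in s, forall u, colour w u = nth c0 l (index u s)}, t' w1 != w
      & colour w (t' w1) = c0]
  end.
have step (n : nat) p : approx x t p ->
    exists q : seq (R * R), [/\ approx x t q, {subset p <= q} & D n q].
  rewrite /D => pA; case: (choice.unpickle n : option task) => [[v|[s l]]|].
  - case: (boolP (v \in unzip1 p)) => [vp|vp]; first by exists p; split.
    have [w [q [_ qA pq vw _]]] := approx_add EP [::] tw pA vp.
    by exists q; split=> //; apply: mem_dom vw.
  (* As [w] avoids the [t']-images of the domain, [t' w] lies off the domain, so the image [w1] of
     [w] can be given colour [c0] towards [t' w]. Applying [t'] then gives the colour of [w] and
     [t' w1]. *)
  - have [w] := EP (s ++ unzip1 p ++ map t' (unzip1 p))
      (fun u => nth c0 l (index u s)).
    rewrite !mem_cat !negb_or => /and3P[ws wp wp'] wP.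
    have t'wp : t' w \notin unzip1 p.
      by apply: contra wp' => H; apply/mapP; exists (t' w); rewrite ?t'K.
    have [w1 [q [w1w qA pq ww1 w1P]]] := approx_add EP [:: t' w] tw pA wp.
    exists q; split=> //; exists w, w1; rewrite inE in w1w; split=> //.
    + by move=> u us; rewrite wP // mem_cat us.
    + by apply: contra w1w => /eqP<-; rewrite t'K.
    have t'w1w : t' w1 != w by apply: contra w1w => /eqP<-; rewrite t'K.
    by rewrite -(w1P (t' w)) ?inE // colour_sym 1?eq_sym // -(aut_colour t') ?t'K.
  - by exists p; split=> //.
have [F [_ FA Fmono FD]] := dependent_chain (approx0 c0 tx) step.
have [|k [kP kt kF _]] := approx_limit FA Fmono.
  move=> v; exists (choice.pickle (inl v : task)).+1.
  by have := FD (choice.pickle (inl v : task)); rewrite /D choice.pickleK.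
exists k; split=> // s f.
pose job : task := inr (s, map f s).
have := FD (choice.pickle job); rewrite /D choice.pickleK => -[w [w1 [ww1 ws wf ww cw]]].
have kw : k w = w1 := kF _ _ ww1.
exists w; rewrite kw; split=> // u us.
by rewrite wf // (nth_map u) ?index_mem // nth_index.
Qed.

(** [W] copies [O] one [t]-orbit at a time: [W o] is a fresh [w], and [W (t o)] must be [t w]. The
    extension property cannot prescribe the colour of [w] and [t' (t w)], which both vary with [w];
    genericity of the pair supplies it. *)
Lemma fresh_block x t t' (Z s : seq R) (F : R -> R -> 'I_m) :
  pointed_involution x t -> pointed_involution x t' -> generic_pair t t' ->
  x \in Z -> {in Z, forall z, t z \in Z} -> x \notin s ->
  let O := [pred u | (u \in s) || (t u \in s)] in
  {in O & Z, forall o z, F (t o) (t z) = F o z} ->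
  exists W : R -> R, [/\
    {in O, forall o, [/\ W o \notin Z, t' (W o) \notin Z, W (t o) = t (W o)
        & {in Z, forall z, colour (W o) z = F o z}]},
    {in O &, forall o o', t' (W o) != W o' /\ colour (W o) (t' (W o')) = c0}
  & {in O &, forall o o', o != o' ->
        W o != W o' /\ colour (W o) (W o') = colour o o'}].
Proof.
move=> tP t'P tt' xZ tZ; have [tK tx t1] := tP; have [t'K t'x t'1] := t'P.
elim: s => [|o s IH] xs O Ft.
  by exists id; split=> [o|o o'|o o'].
have {}IH := IH _ _.
move: xs; rewrite inE negb_or => /andP[xo xs].
pose O' := [pred u | (u \in s) || (t u \in s)].
have O'O : {subset O' <= O}.
  by move=> u; rewrite !inE => /orP[]->; rewrite !orbT.
have [|W [W1 W2 W3]] := IH xs; first by move=> u z /O'O; apply: Ft.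
have tO' u : u \in O' -> t u \in O' by rewrite !inE tK orbC.
have [oO'|oO'] := boolP (o \in O').
  have OO' : {subset O <= O'}.
    move=> u; rewrite inE /= 2!in_cons -orbA => /or4P[/eqP->//|us|/eqP tuo|us].
    - by rewrite inE /= us.
    - by rewrite -[u]tK tuo; apply: tO'.
    - by rewrite inE /= us orbT.
  exists W; split=> [u /OO'|u v /OO' uO /OO'|u v /OO' uO /OO'].
  - exact: W1.
  - exact: W2.
  - exact: W3.
have oO : o \in O by rewrite !inE eqxx.
have ox : o != x by rewrite eq_sym.
(* [T] lists the copy built so far; below, [V] recovers the original of each of its points. *)
pose T := [seq W u | u <- s ++ map t s].
have TP u : u \in O' -> W u \in T.
  move=> uO; apply: map_f; rewrite mem_cat; move: uO; rewrite inE /= => /orP[->//|us].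
  by apply/orP; right; apply/mapP; exists (t u); rewrite ?tK.
have /choice[V VP] : forall u, exists u', u \in T -> u' \in O' /\ W u' = u.
  move=> u; case: (boolP (u \in T)) => [/mapP[u' u's ->]|_]; last by exists u.
  exists u' => _; split=> //; move: u's; rewrite mem_cat inE /= => /orP[->//|].
  by case/mapP=> u2 u2s ->; rewrite tK u2s orbT.
(* Colours follow [F] towards [Z] and [o] towards the copy, and are [c0] elsewhere, in particular
   towards the translates of [T]. The translates of [Z] are listed to keep [t' w] and [t' (t w)] out
   of [Z]. *)
pose f u := if u \in Z then F o u else if u \in T then colour o (V u) else c0.
have [w [w0 w2 w1 w3]] := tt' (Z ++ T ++ map t' T ++ map t (map t' T) ++
   map t' Z ++ map t (map t' Z)) f.
move: w0; rewrite !mem_cat !negb_or => /and5P[wZ wT wt'T wtt'T /andP[wt'Z wtt'Z]].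
have mem_map' g u (S : seq R) : u \in S -> g u \in map g S by move=> ?; apply: map_f.
have wx : w != x by apply: contraNneq wZ => ->.
have twZ : t w \notin Z by apply: contra wZ => /tZ; rewrite tK.
have t'wZ : t' w \notin Z by apply: contra wt'Z => /(mem_map' t'); rewrite t'K.
have t'twZ : t' (t w) \notin Z.
  by apply: contra wtt'Z => /(mem_map' t')/(mem_map' t); rewrite t'K tK.
have cZ z : z \in Z -> colour w z = F o z.
  by move=> zZ; rewrite w2 /f ?zZ // !mem_cat zZ.
have Winj u v : u \in O' -> v \in O' -> W u = W v -> u = v.
  by move=> uO vO E; apply: contra_eq E => uv; have [] := W3 u v uO vO uv.
have cT u : u \in O' -> colour w (W u) = colour o u.
  move=> uO; have [uZ _ _ _] := W1 u uO; have uT := TP u uO.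
  rewrite w2 ?mem_cat ?uT ?orbT // /f (negPf uZ) uT.
  by have [VO /(Winj _ _ VO uO)->] := VP _ uT.
have t'T u : u \in O' -> t' (W u) \notin T.
  move=> uO; apply/negP=> uT; have [VO E] := VP _ uT.
  by have [] := W2 u _ uO VO; rewrite E eqxx.
have ct'T u : u \in O' -> colour w (t' (W u)) = c0.
  move=> uO; have [_ uZ _ _] := W1 u uO; have uT := TP u uO.
  by rewrite w2 ?mem_cat ?(mem_map' t' _ _ uT) ?orbT // /f (negPf uZ) (negPf (t'T u uO)).
have ctt'T u : u \in O' -> colour w (t (t' (W u))) = c0.
  move=> uO; have [_ uZ _ _] := W1 u uO; have uT := TP u uO.
  rewrite w2 ?mem_cat ?(mem_map' t _ _ (mem_map' t' _ _ uT)) ?orbT // /f.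
  rewrite ifN; last by apply: contra uZ => /tZ; rewrite tK.
  rewrite ifN //; apply/negP=> /VP[VO E].
  have [_ _ tW _] := W1 _ VO; have [] := W2 u (t (V (t (t' (W u))))) uO (tO' _ VO).
  by rewrite tW E tK eqxx.
have nT u : u \in O' -> w != W u by move=> /TP uO; apply: contraNneq wT => ->.
have nt'T u : u \in O' -> w != t' (W u).
  by move=> /TP/(mem_map' t') uO; apply: contraNneq wt'T => ->.
have ntt'T u : u \in O' -> w != t (t' (W u)).
  by move=> /TP/(mem_map' t')/(mem_map' t) uO; apply: contraNneq wtt'T => ->.
have to : t o != o by have [] := t1 o ox.
pose W' u := if u == o then w else if u == t o then t w else W u.
have W'o : W' o = w by rewrite /W' eqxx.
have W'to : W' (t o) = t w by rewrite /W' (negPf to) eqxx.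
have W'E u : u \in O' -> W' u = W u.
  move=> uO; rewrite /W'; case: eqP => [E|_]; first by rewrite E (negPf oO') in uO.
  by case: eqP => [E|//]; move: oO'; rewrite -[o]tK -E tO'.
have OP u : u \in O -> [\/ u = o, u = t o | u \in O'].
  rewrite inE /= 2!in_cons -orbA => /or4P[/eqP->|us|/eqP tuo|us].
  - exact: Or31.
  - by apply: Or33; rewrite inE /= us.
  - by apply: Or32; rewrite -tuo tK.
  - by apply: Or33; rewrite inE /= us orbT.
have tw : t w != w by have [] := t1 w wx.
have twt'tw : t' w != t w by apply: contraNneq w1 => <-; rewrite t'K.
have Wt u : u \in O' -> W (t u) = t (W u) by move=> uO; have [] := W1 u uO.
exists W'; split.
- move=> u /OP[->|->|uO]; rewrite ?W'o ?W'to ?tK ?W'o.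
  + by split=> //; rewrite W'to.
  + split=> // z zZ; rewrite -(aut_colour t) ?tK; last by apply: contraNneq twZ => ->.
    by rewrite cZ ?tZ // -[in RHS](tK z) Ft ?tZ.
  + by rewrite !W'E ?tO' //; apply: W1.
- have H1 u : u \in O' -> t' w != W u /\ colour w (t' (W u)) = c0.
    move=> uO; split; last exact: ct'T.
    by apply: contra (nt'T _ uO) => /eqP<-; rewrite t'K.
  have H2 u : u \in O' -> t' (t w) != W u /\ colour (t w) (t' (W u)) = c0.
    move=> uO; split.
      by apply: contra (ntt'T _ uO) => /eqP<-; rewrite t'K tK.
    rewrite -(aut_colour t) ?tK ?ctt'T //.
    by apply: contra (ntt'T _ uO) => /eqP<-; rewrite tK.
  have sym u v : t' u != v /\ colour u (t' v) = c0 -> t' v != u /\ colour v (t' u) = c0.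
    case=> uv cuv; have vu : t' v != u by apply: contra uv => /eqP<-; rewrite t'K.
    split=> //; rewrite colour_sym 1?eq_sym // -(aut_colour t') ?t'K //.
  move=> u v /OP[->|->|uO] /OP[->|->|vO]; rewrite ?W'o ?W'to ?W'E //.
  + by have [] := t'1 w wx.
  + exact: H1.
  + by apply: sym.
  + by apply: t'1; apply: contraNneq twZ => ->.
  + exact: H2.
  + by apply: sym; apply: H1.
  + by apply: sym; apply: H2.
  + exact: W2.
- have H1 u : u \in O' -> w != W u /\ colour w (W u) = colour o u.
    by move=> uO; split; [apply: nT|apply: cT].
  have H2 u : u \in O' -> t w != W u /\ colour (t w) (W u) = colour (t o) u.
    move=> uO; have [n c] := H1 _ (tO' _ uO); rewrite Wt // in n c.
    rewrite -(inj_eq (@aut_inj _ _ t)) tK; split=> //.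
    rewrite -(aut_colour t) ?tK; last by rewrite -(inj_eq (@aut_inj _ _ t)) tK.
    rewrite c -(aut_colour t) ?tK // ; apply: contraNneq oO' => ->; exact: tO'.
  have sym u v u' v' : u != v -> u' != v' /\ colour u' v' = colour u v ->
      v' != u' /\ colour v' u' = colour v u.
    by move=> uv [uv' c]; rewrite eq_sym uv' colour_sym 1?eq_sym // c colour_sym.
  move=> u v /OP[->|->|uO] /OP[->|->|vO]; rewrite ?eqxx ?W'o ?W'to ?W'E // => uv.
  + by rewrite eq_sym; have [_ ->] := t1 w wx; have [_ ->] := t1 o ox.
  + exact: H1.
  + apply: (@sym o (t o)); first by rewrite eq_sym.
    by rewrite eq_sym; have [_ ->] := t1 w wx; have [_ ->] := t1 o ox.
  + exact: H2.
  + by apply: sym; [rewrite eq_sym|apply: H1].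
  + by apply: sym; [rewrite eq_sym|apply: H2].
  + exact: W3.
Qed.

End CommutingInvolutions.

(** * Simultaneous construction of two commuting involutions *)

Section CommutingPairs.
Variables (m : nat) (R : ecgraph m) (c0 : 'I_m).
Implicit Types (u v w x y z : R) (p q : seq (R * R)) (s : seq R).
Implicit Types (e f : R * R).
Notation G := (Aut_ec R).
Implicit Types a b g h t k : G.
Local Notation pointed_involution := (@pointed_involution m R c0).
Local Notation approx := (@approx m R c0).
Local Notation generic_pair := (@generic_pair m R c0).

(* Where both are defined, the partial maps [p] and [q] commute; in particular
   the intersection of their domains is invariant under both. *)
Definition commuting p q := forall u v u', (u, v) \in p -> (u, u') \in q ->
  exists2 v', (v, v') \in q & (u', v') \in p.

Lemma commutingC p q : commuting p q -> commuting q p.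
Proof. by move=> pq u v u' uv uu'; have [v'] := pq _ _ _ uu' uv; exists v'. Qed.

(* The new points [u] receive fresh images [W u] under [p]; commutation and
   equivariance then force [q] at [W u] and at [t' (W u)]. All colours between
   new and forced points can be made [c0] because the pair is generic. *)
Lemma commuting_step x t t' p q v :
  pointed_involution x t -> pointed_involution x t' -> generic_pair t t' ->
  approx x t p -> approx x t' q -> commuting p q ->
  exists p' q', [/\ approx x t p', approx x t' q', commuting p' q'
    & [/\ {subset p <= p'}, {subset q <= q'} & v \in unzip1 p']].
Proof.
move=> tP t'P tt' pA qA pq.
have [tK tx t1] := tP; have [t'K t'x t'1] := t'P.
have [pi px ps pt pc] := pA; have [qi qx qs qt qc] := qA.
(* Besides [v], all points of the domain of [q] are added, so that the new points are stable under
   [q] where it is defined. *)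
pose s := [seq u <- v :: unzip1 q | u \notin unzip1 p].
pose Z := unzip1 p ++ s ++ map t s.
(* As the extended [p] exchanges [u] and [W u], the colour of [W u] and [z] must be that of [u] and
   the image of [z]; it is free when [z] is new. *)
pose F u z := if z \in unzip1 p then colour u (lookup p z) else c0.
pose O := [pred u | (u \in s) || (t u \in s)].
have xp : x \in unzip1 p by apply: mem_dom px.
have xs : x \notin s by rewrite mem_filter xp.
have Op u : u \in O -> u \notin unzip1 p.
  rewrite inE /= => /orP[|]; rewrite mem_filter => /andP[//].
  by rewrite (approx_dom _ tK pA).
have OZ u : u \in O -> u \in Z.
  rewrite inE /= 2!mem_cat => /orP[->|tu]; first by rewrite orbT.
  by apply/or3P; apply: Or33; apply/mapP; exists (t u); rewrite ?tK.
have tO u : u \in O -> t u \in O by rewrite !inE tK orbC.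
have ZP z : z \in Z -> z \in unzip1 p \/ z \in O.
  rewrite 2!mem_cat => /or3P[|zs|/mapP[u us ->]]; first by left.
    by right; rewrite inE /= zs.
  by right; apply: tO; rewrite inE /= us.
have tZ : {in Z, forall z, t z \in Z}.
  move=> z /ZP[zp|/tO/OZ//].
  by rewrite mem_cat (approx_dom _ tK pA) zp.
have xZ : x \in Z by rewrite mem_cat xp.
have lk u : u \in unzip1 p -> lookup p u \in unzip1 p.
  by move/lookupP/ps/mem_dom.
have Ft : {in O & Z, forall u z, F (t u) (t z) = F u z}.
  move=> u z uO _; rewrite /F (approx_dom _ tK pA); case: ifP => // zp.
  rewrite (lookupE pi (pt _ (lookupP zp))) aut_colour //.
  by apply: contraNneq (Op u uO) => ->; apply: lk.
have [W [W1 W2 W3]] := fresh_block tP t'P tt' xZ tZ xs Ft.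
have Winj u u' : u \in O -> u' \in O -> W u = W u' -> u = u'.
  by move=> uO vO E; apply: contra_eq E => uv; have [] := W3 u u' uO vO uv.
have WZ u : u \in O -> W u \notin Z by move/W1=> [].
have t'WZ u : u \in O -> t' (W u) \notin Z by move/W1=> [].
have WP u z : u \in O -> z \in Z -> colour (W u) z = F u z.
  by move=> uO zZ; have [_ _ _] := W1 u uO; apply.
have Wp u : u \in O -> W u \notin unzip1 p.
  by move=> /WZ; apply: contra => up; rewrite mem_cat up.
have nWZ u z : u \in O -> z \in Z -> W u != z.
  by move=> /WZ uZ zZ; apply: contraNneq uZ => ->.
have nt'WZ u z : u \in O -> z \in Z -> t' (W u) != z.
  by move=> /t'WZ uZ zZ; apply: contraNneq uZ => ->.
have FO u u' : u' \in O -> F u u' = c0 by move=> /Op u'p; rewrite /F (negPf u'p).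
pose N := [seq (u, W u) | u <- s ++ map t s].
have NP e : e \in N -> e.1 \in O /\ e.2 = W e.1.
  move=> /mapP[u us ->]; split=> //=; move: us.
  rewrite inE /= mem_cat => /orP[->//|/mapP[u' us ->]].
  by rewrite tK us orbT.
have NE u : u \in O -> (u, W u) \in N.
  move=> uO; apply: map_f; rewrite mem_cat; move: uO; rewrite inE /= => /orP[->//|us].
  by apply/orP; right; apply/mapP; exists (t u); rewrite ?tK.
have OW u : u \in O -> u != W u by move=> uO; rewrite eq_sym nWZ ?OZ.
have WO u u' : u \in O -> u' \in O -> colour (W u) u' = c0.
  by move=> uO u'O; rewrite WP ?OZ ?FO.
have Ni : partial_iso N.
  move=> [u w] [u' w'] /NP[/= uO ->] /NP[/= u'O ->].
  case: (eqVneq u u') => [->|uu']; first exact: compat_refl.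
  by have [] := W3 _ _ uO u'O uu'; apply: compat_neq.
have pN : {in p & N, forall e f, compat e f}.
  move=> [u u'] [w w'] uu' /NP[/= wO ->]; apply: compat_sym.
  have u'p : u' \in unzip1 p by apply: mem_dom (ps _ _ uu').
  apply: compat_neq; first by apply: contraNneq (Op w wO) => ->; apply: mem_dom uu'.
    by apply: nWZ; rewrite // mem_cat u'p.
  by rewrite WP ?mem_cat ?u'p // /F u'p (lookupE pi (ps _ _ uu')).
have pN' : {in p & flip N, forall e f, compat e f}.
  by move=> [u u'] [w w'] /ps uu'; rewrite mem_flip => /(pN _ _ uu')/compat_flip.
have NN' : {in N & flip N, forall e f, compat e f}.
  move=> [u w] [w' u'] /NP[/= uO ->]; rewrite mem_flip => /NP[/= u'O ->].
  apply: compat_neq; first by rewrite eq_sym nWZ ?OZ.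
    by rewrite nWZ ?OZ.
  by rewrite WO // colour_sym ?WO // eq_sym nWZ ?OZ.
pose p' := p ++ N ++ flip N.
have p'A : approx x t p'.
  split.
  - apply: partial_iso_cat => //.
      by apply: partial_iso_cat => //; apply: partial_iso_flip.
    by move=> e f ep; rewrite mem_cat => /orP[]; [apply: pN|apply: pN'].
  - by rewrite mem_cat px.
  - move=> u w; rewrite !mem_cat => /or3P[/ps->//|uw|].
      by rewrite (mem_flip N) uw !orbT.
    by rewrite mem_flip => ->; rewrite orbT.
  - have Nt : equivariant t t N.
      by move=> e /NP[/= eO ->]; have [_ _ <- _] := W1 _ eO; apply/NE/tO.
    move=> e; rewrite !mem_cat => /or3P[/pt->//|/Nt->|]; rewrite ?orbT //.
    by move=> /(equivariant_flip Nt)->; rewrite !orbT.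
  - move=> u w; rewrite 2!mem_cat mem_flip => /or3P[/pc//|/NP[/= uO ->] _|].
      by split; [exact: OW|rewrite colour_sym ?OW ?WO].
    by move=> /NP[/= wO ->] _; split; [rewrite eq_sym OW|rewrite WO].
have sq u : u \in unzip1 q -> u \notin unzip1 p -> u \in O.
  by move=> uq up; rewrite inE /= mem_filter up inE uq orbT.
pose A := [seq (W e.1, W e.2) | e <- q & e.1 \notin unzip1 p].
pose B := [seq (t' e.1, t' e.2) | e <- A].
have qO u u' : (u, u') \in q -> u \notin unzip1 p -> u \in O /\ u' \in O.
  move=> uu' up; split; first by apply: sq => //; apply: mem_dom uu'.
  apply: sq; first by apply: mem_dom (qs _ _ uu').
  apply: contra up => /mem_domP[w u'w].
  by have [w' _ /mem_dom] := pq _ _ _ u'w (qs _ _ uu').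
have AP w w' : (w, w') \in A ->
    exists u u', [/\ (u, u') \in q, u \in O, u' \in O, w = W u & w' = W u'].
  move=> /mapP[[u u']]; rewrite mem_filter => /andP[/= up uu'] [-> ->].
  by have [] := qO _ _ uu' up; exists u, u'.
have AE u u' : (u, u') \in q -> u \in O -> (W u, W u') \in A.
  by move=> uu' uO; apply/mapP; exists (u, u'); rewrite // mem_filter /= Op.
have BP w w' : (w, w') \in B ->
    exists u u', [/\ (u, u') \in q, u \in O, u' \in O, w = t' (W u) & w' = t' (W u')].
  move=> /mapP[[w1 w1']] /AP[u [u' [uu' uO u'O -> ->]]] [-> ->].
  by exists u, u'.
have BE u u' : (u, u') \in q -> u \in O -> (t' (W u), t' (W u')) \in B.
  by move=> uu' uO; apply/mapP; exists (W u, W u') => //; apply: AE.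
have qZ u u' : (u, u') \in q -> u \in Z.
  move=> uu'; have [up|up] := boolP (u \in unzip1 p); first by rewrite mem_cat up.
  by apply/OZ/sq => //; apply: mem_dom uu'.
have Ai : partial_iso A.
  move=> [w1 w1'] [w2 w2'] /AP[u [u' [uu' uO u'O -> ->]]] /AP[y [y' [yy' yO y'O -> ->]]].
  have [E C] := qi _ _ uu' yy'; case: (eqVneq u y) => [uy|uy].
    by move: E; rewrite /= uy eqxx => /esym/eqP->; apply: compat_refl.
  have u'y' : u' != y' by rewrite /= (negPf uy) in E; rewrite -E.
  have [n1 c1] := W3 _ _ uO yO uy; have [n2 c2] := W3 _ _ u'O y'O u'y'.
  by apply: compat_neq => //; rewrite c1 c2 C.
have Bi : partial_iso B.
  by move=> _ _ /mapP[e eA ->] /mapP[f fA ->]; apply: compat_act; apply: Ai.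
have qAi : {in q & A, forall e f, compat e f}.
  move=> [u u'] [w w'] uu' /AP[y [y' [yy' yO y'O -> ->]]]; apply: compat_sym.
  have u'Z := qZ _ _ (qs _ _ uu'); have uZ := qZ _ _ uu'.
  apply: compat_neq; rewrite ?nWZ // !WP // /F.
  (* If [u] is in the domain of [p], commutation shows that [q] also relates the [p]-images of [u]
     and [u']; otherwise both colours are [c0]. *)
  case: (boolP (u \in unzip1 p)) => up.
    have [z zu' u'z] := pq _ _ _ (lookupP up) uu'.
    rewrite (mem_dom u'z) (lookupE pi u'z); have [_ -> //=] := qi _ _ yy' zu'.
    by apply: contraNneq (Op _ yO) => ->; apply: lk.
  by have [_ u'O] := qO _ _ uu' up; rewrite (negPf (Op _ u'O)).
have qBi : {in q & B, forall e f, compat e f}.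
  move=> e _ eq /mapP[f fA ->]; have := compat_act t' t' (qAi _ _ (qt _ eq) fA).
  by rewrite /= !t'K; case: e eq.
have ABi : {in A & B, forall e f, compat e f}.
  move=> [w1 w1'] [w2 w2'] /AP[u [u' [uu' uO u'O -> ->]]] /BP[y [y' [yy' yO y'O -> ->]]].
  have [n1 _] := W2 _ _ yO uO; have [n2 _] := W2 _ _ y'O u'O.
  have [_ c1] := W2 _ _ uO yO; have [_ c2] := W2 _ _ u'O y'O.
  by apply: compat_neq; rewrite 1?eq_sym // c1.
pose q' := q ++ A ++ B.
have As u u' : (u, u') \in A -> (u', u) \in A.
  by move=> /AP[y [y' [yy' yO y'O -> ->]]]; apply: AE => //; apply: qs.
have neqO u u' : (u, u') \in q -> u \in O -> u != u' /\ colour u u' = c0.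
  move=> uu' uO; apply: qc uu' _; apply: contraNneq (Op _ uO) => ->; exact: xp.
have Ac u u' : (u, u') \in A -> u != u' /\ colour u u' = c0.
  move=> /AP[y [y' [yy' yO y'O -> ->]]]; have [n c] := neqO _ _ yy' yO.
  by have [? ->] := W3 _ _ yO y'O n.
have q'A : approx x t' q'.
  split.
  - apply: partial_iso_cat => //; first exact: partial_iso_cat.
    by move=> e f ep; rewrite mem_cat => /orP[]; [apply: qAi|apply: qBi].
  - by rewrite mem_cat qx.
  - move=> u w; rewrite !mem_cat => /or3P[/qs->//|/As->|]; first by rewrite orbT.
    move=> /mapP[[y y'] /As yy' [-> ->]].
    by apply/or3P; apply: Or33; apply/mapP; exists (y', y).
  - move=> e; rewrite !mem_cat => /or3P[/qt->//|eA|/mapP[f fA ->]].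
      by apply/or3P; apply: Or33; apply/mapP; exists e.
    by rewrite /= !t'K -surjective_pairing fA orbT.
  - move=> u w; rewrite 2!mem_cat => /or3P[/qc//|/Ac//|/mapP[[y y'] /Ac[n c] [-> ->]]] _.
    by rewrite (inj_eq (@aut_inj _ _ _)) aut_colour.
exists p', q'; split=> //; last first.
  split=> [e ep|e eq|]; rewrite ?mem_cat ?ep ?eq //.
  case: (boolP (v \in unzip1 p)) => [/mem_domP[w vw]|vp].
    by apply: (@mem_dom _ _ _ _ w); rewrite mem_cat vw.
  have vO : v \in O by rewrite inE /= mem_filter vp inE eqxx.
  by apply: (@mem_dom _ _ _ _ (W v)); rewrite 2!mem_cat NE ?orbT.
(* Of the nine combinations only [p] with [q], [N] with [q], and [flip N] with [A] occur; freshness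
   of the copy excludes the others. *)
move=> u w u'; rewrite 2!mem_cat mem_flip => /or3P[uw|/NP[/= uO ->]|/NP[/= wO ->]];
  rewrite 2!mem_cat => /or3P[].
- by move=> uu'; have [w' ? ?] := pq _ _ _ uw uu'; exists w'; rewrite mem_cat; apply/orP; left.
- move=> /AP[y [y' [_ yO _ E _]]]; case/negP: (Wp _ yO).
  by rewrite -E (mem_dom uw).
- move=> /BP[y [y' [_ yO _ E _]]]; case/negP: (t'WZ _ yO).
  by rewrite -E mem_cat (mem_dom uw).
- move=> uu'; have [_ u'O] := qO _ _ uu' (Op _ uO).
  exists (W u'); rewrite 2!mem_cat ?AE ?NE ?orbT //.
- move=> /AP[y [y' [_ yO _ E _]]]; case/negP: (WZ _ yO).
  by rewrite -E OZ.
- move=> /BP[y [y' [_ yO _ E _]]]; case/negP: (t'WZ _ yO).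
  by rewrite -E OZ.
- by move=> /qZ; rewrite (negPf (WZ _ wO)).
- move=> /AP[y [y' [yy' yO y'O E ->]]]; have wy := Winj _ _ wO yO E.
  by exists y'; rewrite 2!mem_cat ?mem_flip ?NE ?orbT // wy yy'.
- move=> /BP[y [y' [_ yO _ E _]]]; have [] := W2 _ _ yO wO.
  by rewrite E eqxx.
Qed.

(** Each stage extends [p] and then [q] with the roles exchanged, which is possible because
    genericity and commutation are symmetric. *)
Lemma commuting_pair x t t' :
  pointed_involution x t -> pointed_involution x t' -> generic_pair t t' ->
  exists k k' : G, [/\ pointed_involution x k, pointed_involution x k',
    forall v, k (t v) = t (k v), forall v, k' (t' v) = t' (k' v)
    & forall v, k (k' v) = k' (k v)].
Proof.
move=> tP t'P tt'; have [tK tx _] := tP; have [t'K t'x _] := t'P.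
have t't := generic_pairC tK t'K tt'.
pose S pq := [/\ approx x t pq.1, approx x t' pq.2 & commuting pq.1 pq.2].
pose le (pq pq' : seq (R * R) * seq (R * R)) :=
  {subset pq.1 <= pq'.1} /\ {subset pq.2 <= pq'.2}.
pose D (n : nat) (pq : seq (R * R) * seq (R * R)) := forall v,
  choice.unpickle n = Some v -> v \in unzip1 pq.1 /\ v \in unzip1 pq.2.
have S0 : S ([:: (x, x)], [:: (x, x)]).
  split; [exact: approx0 | exact: approx0 |] => u v u'.
  by rewrite !inE => /eqP[-> ->] /eqP[->]; exists x; rewrite inE.
have step (n : nat) pq : S pq -> exists pq', [/\ S pq', le pq pq' & D n pq'].
  case: pq => p q [/= pA qA pq]; rewrite /D.
  case: (choice.unpickle n) => [v|]; last first.
    by exists (p, q); split=> //; split.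
  have [p1 [q1 [p1A q1A pq1 [pp1 qq1 vp1]]]] := commuting_step v tP t'P tt' pA qA pq.
  have [q2 [p2 [q2A p2A qp2 [qq2 pp2 vq2]]]] :=
    commuting_step v t'P tP t't q1A p1A (commutingC pq1).
  exists (p2, q2); split; [split=> //; exact: commutingC | split=> e /= |].
  - by move/pp1/pp2.
  - by move/qq1/qq2.
  - move=> _ [<-] /=; split=> //.
    by have /mem_domP[w /pp2/mem_dom] := vp1.
have [F [_ FS Fle FD]] := dependent_chain S0 step.
have FDv v : v \in unzip1 (F (choice.pickle v).+1).1 /\ v \in unzip1 (F (choice.pickle v).+1).2.
  exact: FD (choice.pickleK v).
have [|||k [kP kt kF kD]] := @approx_limit _ _ c0 x t (fun n => (F n).1).
- by move=> n; case: (FS n).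
- by move=> n; case: (Fle n).
- by move=> v; exists (choice.pickle v).+1; case: (FDv v).
have [|||k' [k'P k't kF' kD']] := @approx_limit _ _ c0 x t' (fun n => (F n).2).
- by move=> n; case: (FS n).
- by move=> n; case: (Fle n).
- by move=> v; exists (choice.pickle v).+1; case: (FDv v).
exists k, k'; split=> // v.
have [i vi] := kD v; have [j vj] := kD' v.
have mono1 : forall n, {subset (F n).1 <= (F n.+1).1} by move=> n; case: (Fle n).
have mono2 : forall n, {subset (F n).2 <= (F n.+1).2} by move=> n; case: (Fle n).
have [_ _ C] := FS (maxn i j).
have [w /kF' /= E1 /kF /= E2] := C _ _ _ (chain_subset mono1 (leq_maxl i j) vi)
  (chain_subset mono2 (leq_maxr i j) vj).
by rewrite E1 E2.
Qed.

End CommutingPairs.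

(** * Existential definition of the point stabilisers *)

Section StabiliserDefinability.

Definition commuting_path (gT : groupType) (t h a b c : gT) :=
  [/\ commute t (t ^ a), commute (t ^ a) (t ^ b), commute (t ^ b) (t ^ c)
    & commute (t ^ c) (t ^ h)].

Variables (m : nat) (R : ecgraph m) (c0 : 'I_m).
Hypothesis EP : extension_property R.
Implicit Types (u v w x y z : R).
Notation G := (Aut_ec R).
Implicit Types a b c g h t k : G.
Local Notation pointed_involution := (@pointed_involution m R c0).

Lemma pointed_involution_exists x : exists t : G, pointed_involution x t.
Proof.
have [//|t [tP _ _]] := generic_commuting_involution EP (t' := 1) (weak_involution1 c0 x).
by exists t.
Qed.

Lemma pointed_involution_conj x t h : pointed_involution x t ->
  pointed_involution (h x) (t ^ h).
Proof.
case=> tK tx t1; split=> [v||v].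
- by rewrite !autJ autK tK autKV.
- by rewrite autJ autK tx.
rewrite -[v](autKV h); move: (h^-1 v) => u.
rewrite autJ autK !(inj_eq (@aut_inj _ _ h)) => /t1[n c]; split=> //.
by rewrite aut_colour // eq_sym.
Qed.

(** Back and forth starting from the pair [(x, x)], outside which the two involutions look alike. *)
Lemma pointed_involutions_conjugate x t t' :
  pointed_involution x t -> pointed_involution x t' -> exists a : G, t ^ a = t'.
Proof.
move=> [tK tx t1] [t'K t'x t'1].
have al : alike c0 t t' [:: (x, x)].
  move=> v w; rewrite !inE => /t1[n c] /t'1[n' c'].
  by rewrite (negPf n) (negPf n').
have pi : partial_iso [:: (x, x)].
  by move=> e f; rewrite !inE => /eqP-> /eqP->; apply: compat_refl.
have eqv : equivariant t t' [:: (x, x)].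
  by move=> e; rewrite !inE => /eqP-> /=; rewrite tx t'x.
have [a _ aP] := equivariant_extension EP tK t'K al pi eqv.
by exists a; apply: aut_eq => v; rewrite autJ aP autKV.
Qed.

(** Commuting pointed involutions have the same fixed point, since each preserves the fixed point
    set of the other; so [x] and [h x], the fixed points of [t] and [t ^ h], agree along a path.
    Conversely, the path goes through [k1], generic with respect to [t ^ h], then [k] and [k']. *)
Lemma stabiliserP x t h : pointed_involution x t ->
  h x = x <-> exists a b c, commuting_path t h a b c.
Proof.
move=> tP; split=> [hx|[a [b [c [ta ab bc ch]]]]].
  have t'P := pointed_involution_conj h tP; rewrite hx in t'P; have [t'K _ _] := t'P.
  have [k1 [k1P k1t gen]] := generic_commuting_involution EP (pointed_weak tP) t'K.
  have [k [k' [kP k'P kk1 k't' kk']]] := commuting_pair k1P t'P gen.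
  have [a ta] := pointed_involutions_conjugate tP k1P.
  have [b tb] := pointed_involutions_conjugate tP kP.
  have [c tc] := pointed_involutions_conjugate tP k'P.
  exists a, b, c; rewrite /commuting_path ta tb tc.
  by split; apply: aut_eq => v; rewrite !autM ?k1t ?kk1 ?kk' ?k't'.
have pc y z k k' : pointed_involution y k -> pointed_involution z k' ->
    commute k k' -> y = z.
  move=> [_ ky k1] [_ k'z k'1] kk'.
  have kz : k' (k z) = k z by rewrite -autM kk' autM k'z.
  have {}kz : k z = z by apply: contra_eq kz => /k'1[].
  by apply: esym; apply: contra_eq kz => /k1[].
have tJ g := pointed_involution_conj g tP.
by rewrite -(pc _ _ _ _ (tJ c) (tJ h) ch) -(pc _ _ _ _ (tJ b) (tJ c) bc)
  -(pc _ _ _ _ (tJ a) (tJ b) ab) -(pc _ _ _ _ tP (tJ a) ta).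
Qed.

End StabiliserDefinability.

(* A space is presented by the codes [e n] of its points up to precision [n];
   the balls are the sets of points sharing a code. *)
Section Codings.
Variables (X : Type) (C : Type) (e : nat -> X -> C).

Definition coding := forall n x y, e n.+1 x = e n.+1 y -> e n x = e n y.

Definition complete := forall u : nat -> X,
  (forall n, e n (u n.+1) = e n (u n)) -> exists x, forall n, e n x = e n (u n).

End Codings.

(** * Baire category and projections of closed sets *)

Section Baire.
Variables (X : Type) (C : countType) (e : nat -> X -> C).

Definition ball n x : X -> Prop := fun y => e n y = e n x.

Definition nowhere_dense (F : X -> Prop) := forall n x, exists k y,
  [/\ (n <= k)%N, ball n x y & forall z, ball k y z -> ~ F z].

Definition meagre (A : X -> Prop) := exists F : nat -> X -> Prop,
  (forall k, nowhere_dense (F k)) /\ forall x, A x -> exists k, F k x.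

Hypotheses (eC : coding e) (eX : complete e).

Lemma coding_le n k x y : (n <= k)%N -> e k x = e k y -> e n x = e n y.
Proof. by move=> /subnK<-; elim: (k - n)%N => //= d IH /eC. Qed.

Lemma meagre_sub (A B : X -> Prop) : (forall x, A x -> B x) -> meagre B -> meagre A.
Proof. by move=> AB [F [Fn BF]]; exists F; split=> // x /AB/BF. Qed.

Lemma meagre_nowhere_dense (F : X -> Prop) : nowhere_dense F -> meagre F.
Proof. by move=> Fn; exists (fun=> F); split=> // x Fx; exists 0. Qed.

Lemma nowhere_dense0 : nowhere_dense (fun=> False).
Proof. by move=> n x; exists n, x; split=> // z _ []. Qed.

Lemma meagre_bigcup (I : countType) (A : I -> X -> Prop) :
  (forall i, meagre (A i)) -> meagre (fun x => exists i, A i x).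
Proof.
move=> /choice[F FP].
pose H n x := if choice.unpickle n is Some (i, k) then F i k x else False.
exists H; split=> [n|x [i Aix]]; last first.
  have [_ /(_ x Aix)[k Fk]] := FP i.
  by exists (choice.pickle (i, k)); rewrite /H choice.pickleK.
rewrite /H; case: (choice.unpickle n) => [[i k]|].
  by have [Fn _] := FP i; apply: Fn.
exact: nowhere_dense0.
Qed.

Lemma meagreU (A B : X -> Prop) :
  meagre A -> meagre B -> meagre (fun x => A x \/ B x).
Proof.
move=> mA mB; apply: (@meagre_sub _ (fun x => exists b : bool, (if b then A else B) x)).
  by move=> x [Ax|Bx]; [exists true|exists false].
by apply: meagre_bigcup => -[].
Qed.

Theorem baire n x : ~ meagre (ball n x).
Proof.
move=> [F [Fn FB]].
(* A stage is a ball given by its precision and its centre; the precision grows strictly, so that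
   the centres converge. *)
pose S (p : nat * X) := ball n x p.2 /\ (n <= p.1)%N.
pose le (p q : nat * X) := (p.1 < q.1)%N /\ e p.1 q.2 = e p.1 p.2.
pose D k (p : nat * X) := forall z, ball p.1 p.2 z -> ~ F k z.
have S0 : S (n, x) by [].
have step k p : S p -> exists q, [/\ S q, le p q & D k q].
  case: p => j y [/= yx nj]; have [i [z [ji zy zF]]] := Fn k j y.
  exists (i.+1, z); split=> [||w /eC/zF//]; split=> //=.
  - by rewrite /ball (coding_le nj zy).
  - exact: leqW (leq_trans nj ji).
have [f [f0 fS fle fD]] := dependent_chain S0 step.
have fk k : (k <= (f k).1)%N.
  by elim: k => // k IH; apply: leq_ltn_trans IH _; case: (fle k).
have [|z zP] := eX (u := fun k => (f k).2).
  by move=> k; have [_ /(coding_le (fk k))] := fle k.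
have mono i j : (i <= j)%N -> e (f i).1 (f j).2 = e (f i).1 (f i).2.
  move=> /subnK<-; elim: (j - i)%N => // d IH; rewrite -IH addSn.
  have [_ E] := fle (d + i)%N; apply: coding_le E.
  elim: d {IH} => // d IH; apply: leq_trans IH (ltnW _); by case: (fle (d + i)%N).
have zf k : ball (f k).1 (f k).2 z.
  by rewrite /ball zP; apply: mono.
have zx : ball n x z by have := zf 0; rewrite /ball f0.
have [k Fk] := FB z zx.
exact: fD k z (zf k.+1) Fk.
Qed.

Definition heavy (A : X -> Prop) n x := forall k y, (n <= k)%N -> ball n x y ->
  ~ meagre (fun z => A z /\ ball k y z).

Lemma heavy_ball A n x y : ball n x y -> heavy A n x -> heavy A n y.
Proof. by move=> yx H k z nk zy; apply: H => //; rewrite /ball zy. Qed.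

(** Otherwise every subball contains a ball in which [A] is meagre. The points of [A] around which
    there is such a ball are covered by countably many of them, since balls are named by codes; the
    remaining points form a nowhere dense set. *)
Lemma nonmeagre_heavy (A : X -> Prop) n x :
  ~ meagre (fun y => A y /\ ball n x y) ->
  exists k y, [/\ (n <= k)%N, ball n x y & heavy A k y].
Proof.
move=> nm; apply: contrapT => nh; apply: nm.
have light k y : (n <= k)%N -> ball n x y -> exists j z,
    [/\ (k <= j)%N, ball k y z & meagre (fun w => A w /\ ball j z w)].
  move=> nk yx; apply: contrapT => nl; apply: nh; exists k, y; split=> //.
  by move=> j z kj zy mz; apply: nl; exists j, z.
pose F y := ball n x y /\ forall j, ~ meagre (fun w => A w /\ ball j y w).
pose M (jc : nat * C) y := [/\ A y, e jc.1 y = jc.2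
  & meagre (fun w => A w /\ ball jc.1 y w)].
apply: (@meagre_sub _ (fun y => F y \/ exists jc, M jc y)).
  move=> y [Ay yx]; case: (pselect (exists j, meagre (fun w => A w /\ ball j y w))).
    by move=> [j mj]; right; exists (j, e j y).
  by move=> nj; left; split=> // j mj; apply: nj; exists j.
apply: meagreU.
  apply: meagre_nowhere_dense => k y.
  have [zx|zx] := eqVneq (e n y) (e n x); last first.
    exists (maxn n k), y; split=> //; first exact: leq_maxr.
    move=> z zy [xz _]; case/eqP: zx; rewrite -xz; apply: esym.
    exact: coding_le (leq_maxl n k) zy.
  have [j [z [kj zy mz]]] := light (maxn n k) y (leq_maxl _ _) zx.
  exists j, z; split; [exact: leq_trans (leq_maxr n k) kj | |].
    exact: coding_le (leq_maxr n k) zy.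
  move=> w wz [_ /(_ j)]; apply; apply: meagre_sub mz => w' [Aw' w'w].
  by split=> //; rewrite /ball w'w.
apply: meagre_bigcup => -[j c]; case: (pselect (exists y, M (j, c) y)); last first.
  move=> nM; apply: (@meagre_sub _ (fun=> False)) => [y My|]; first by apply: nM; exists y.
  by apply: meagre_nowhere_dense; apply: nowhere_dense0.
move=> [y [_ /= yc my]]; apply: meagre_sub my => z [Az zc _].
by split=> //; rewrite /ball yc.
Qed.

Variables (W : Type) (C' : countType) (e' : nat -> W -> C').
Hypotheses (eC' : coding e') (eW : complete e').
Variable Z : X -> W -> Prop.
Hypothesis Z_closed : forall x w,
  (forall n, exists x' w', [/\ Z x' w', e n x' = e n x & e' n w' = e' n w]) ->
  Z x w.

(* The projection of a closed set has the property of Baire: points of a heavy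
   ball outside a meagre set have a branch of heavy approximate witnesses. *)
Theorem analytic_comeagre : ~ meagre (fun x => exists w, Z x w) ->
  exists n x, meagre (fun y => ball n x y /\ ~ exists w, Z y w).
Proof.
move=> nm; pose A n c x := exists2 w, Z x w & e' n w = c.
have [c [n0 [x0 h0]]] : exists c n x, heavy (A 0 c) n x.
  apply: contrapT => nh; apply: nm.
  apply: (@meagre_sub _ (fun x => exists nc : C * C', A 0 nc.2 x /\ e 0 x = nc.1)).
    by move=> x [w Zw]; exists (e 0 x, e' 0 w); split=> //; exists w.
  apply: meagre_bigcup => -[d c]; apply: contrapT => nmA.
  have [x dx] : exists x, e 0 x = d.
    apply: contrapT => nx; apply: nmA; apply: (@meagre_sub _ (fun=> False)).
      by move=> x [_ dx]; apply: nx; exists x.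
    by apply: meagre_nowhere_dense; apply: nowhere_dense0.
  have [|n [y [_ _ H]]] := @nonmeagre_heavy (A 0 c) 0 x.
    by rewrite /ball dx.
  by apply: nh; exists c, n, y.
exists n0, x0.
pose next n c c' := exists w, e' n w = c /\ e' n.+1 w = c'.
(* These are the points where a heavy [A n c] has no heavy refinement. They form a nowhere dense set
   for each code, and all other points of the ball will lie in the projection. *)
pose N (nc : nat * C') y := (exists k, heavy (A nc.1 nc.2) k y) /\
  ~ exists c' k, next nc.1 nc.2 c' /\ heavy (A nc.1.+1 c') k y.
apply: (@meagre_sub _ (fun y => exists nc, N nc y)); last first.
  apply: meagre_bigcup => -[n d]; apply: meagre_nowhere_dense => k x.
  case: (pselect (exists j y, [/\ (k <= j)%N, ball k x y
      & meagre (fun z => A n d z /\ ball j y z)])) => [[j [y [kj yx my]]]|nmy].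
    exists j, y; split=> // z zy [[i hz] _]; apply: (hz (maxn i j) z) => //.
      exact: leq_maxl.
    apply: meagre_sub my => w [Aw wz]; split=> //.
    by rewrite /ball (coding_le (leq_maxr i j) wz).
  (* [A n d] is the countable union of its refinements, so one of them is not meagre here, hence
     heavy in some subball. *)
  have : exists c', next n d c' /\ ~ meagre (fun z => A n.+1 c' z /\ ball k x z).
    apply: contrapT => nc; apply: nmy; exists k, x; split=> //.
    apply: (@meagre_sub _ (fun z => exists c', next n d c' /\ (A n.+1 c' z /\ ball k x z))).
      move=> z [[w Zw wd] zx]; exists (e' n.+1 w); split; first by exists w.
      by split=> //; exists w.
    apply: meagre_bigcup => c'; case: (pselect (next n d c')) => nx; last first.
      apply: (@meagre_sub _ (fun=> False)); first by move=> z [].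
      by apply: meagre_nowhere_dense; apply: nowhere_dense0.
    apply: (@meagre_sub _ (fun z => A n.+1 c' z /\ ball k x z)); first by move=> z [].
    by apply: contrapT => nmz; apply: nc; exists c'.
  move=> [c' [nc /nonmeagre_heavy[j [y [kj yx hy]]]]].
  exists j, y; split=> // z zy [_]; apply; exists c', j; split=> //.
  exact: heavy_ball hy.
move=> y [yx nA]; apply: contrapT => nN; apply: nA.
pose S (nc : nat * C') := exists k, heavy (A nc.1 nc.2) k y.
pose le (p q : nat * C') := q.1 = p.1.+1 /\ next p.1 p.2 q.2.
have S0 : S (0, c) by exists n0; apply: heavy_ball h0.
have step (n : nat) p : S p -> exists q, [/\ S q, le p q & True].
  move=> Sp; apply: contrapT => nq; apply: nN; exists p; split=> // -[c' [k [nx hk]]].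
  by apply: nq; exists (p.1.+1, c'); split=> //; exists k.
have [f [f0 fS fle _]] := dependent_chain S0 step.
have f1 n : (f n).1 = n by elim: n => [|n IH]; [rewrite f0|case: (fle n) => ->; rewrite IH].
(* A heavy set meets every small ball around [y], so each code of the branch has a witness over a
   point arbitrarily close to [y]; these witnesses converge. *)
have /choice[u uP] : forall n, exists yw : X * W,
    [/\ Z yw.1 yw.2, e n yw.1 = e n y & e' n yw.2 = (f n).2].
  move=> n; have [k hk] := fS n; apply: contrapT => nyw.
  apply: (hk (maxn k n) y) => //; first exact: leq_maxl.
  apply: (@meagre_sub _ (fun=> False)) => [z [[w Zw wf] zy]|].
    apply: nyw; exists (z, w); split=> //=; last by rewrite -wf f1.
    exact: coding_le (leq_maxr k n) zy.
  by apply: meagre_nowhere_dense; apply: nowhere_dense0.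
have [|w wP] := eW (u := fun n => (u n).2).
  move=> n; have [_ _ E] := uP n; have [_ _ E'] := uP n.+1.
  have [_ [w [wn wn']]] := fle n; rewrite f1 in wn wn'.
  by rewrite E -wn; apply: eC'; rewrite E' wn'.
exists w; apply: Z_closed => n; have [Zn En E'n] := uP n.
by exists (u n).1, (u n).2; split.
Qed.

End Baire.

(** * The topology of the automorphism group and automatic continuity *)

Section AutomorphismSpace.
Variables (m : nat) (R : ecgraph m).
Implicit Types (u v x : R) (s : seq R).
Notation G := (Aut_ec R).
Implicit Types a b c g h k t : G.

(* Inverses are coded as well, so that limits of automorphisms are bijective. *)
Definition aut_code (n : nat) g : seq (option (R * R)) :=
  [seq omap (fun v => (g v, g^-1 v)) (choice.unpickle i) | i <- iota 0 n].

Definition agree s g h := {in s, forall v, g v = h v /\ g^-1 v = h^-1 v}.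

Definition pointwise_stabiliser s g := {in s, forall v, g v = v}.

Lemma aut_codeP n g h : aut_code n g = aut_code n h <->
  forall i v, (i < n)%N -> choice.unpickle i = Some v ->
    g v = h v /\ g^-1 v = h^-1 v.
Proof.
rewrite /aut_code; split=> [E i v ni iv|H].
  have iN : i \in iota 0 n by rewrite mem_iota.
  by have := (eq_in_map _ _ _).2 E i iN; rewrite iv => -[].
apply/eq_in_map => i; rewrite mem_iota add0n => ni.
case iv: (choice.unpickle i) => [v|//]; have [E E'] := H i v ni iv.
by congr (Some (_, _)).
Qed.

Lemma aut_coding : coding aut_code.
Proof.
move=> n g h /aut_codeP H; apply/aut_codeP => i v ni; apply: H; exact: ltnW.
Qed.

(** Together with [aut_code_agree]: balls and agreement on finite lists define the same topology. *)
Lemma agree_aut_code s : exists n, forall g h,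
  aut_code n g = aut_code n h -> agree s g h.
Proof.
elim: s => [|v s [n IH]]; first by exists 0.
exists (maxn n (choice.pickle v).+1) => g h E w; rewrite inE => /predU1P[->|ws].
  by apply: (proj1 (aut_codeP _ g h) E) (choice.pickleK v); rewrite leq_max leqnn orbT.
by apply: IH ws; apply: (coding_le aut_coding) (leq_maxl _ _) E.
Qed.

Lemma aut_code_agree n : exists s, forall g h,
  agree s g h -> aut_code n g = aut_code n h.
Proof.
exists (pmap choice.unpickle (iota 0 n)) => g h gh; apply/aut_codeP => i v ni iv.
by apply: gh; rewrite mem_pmap -iv map_f // mem_iota.
Qed.

Lemma aut_complete : complete aut_code.
Proof.
move=> f fS; pose N v := (choice.pickle v).+1.
have fle i j : (i <= j)%N -> aut_code i (f j) = aut_code i (f i).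
  move=> /subnK<-; elim: (j - i)%N => // d <-; rewrite addSn.
  exact: (coding_le aut_coding) (leq_addl d i) (fS _).
have fv v j : (N v <= j)%N -> f j v = f (N v) v /\ (f j)^-1 v = (f (N v))^-1 v.
  by move=> /fle/aut_codeP/(_ _ v (leqnn _) (choice.pickleK v)).
pose F v := f (N v) v; pose F' v := (f (N v))^-1 v.
have FK : cancel F F'.
  move=> v; pose j := maxn (N v) (N (F v)).
  have [E _] := fv v j (leq_maxl _ _); have [_ E'] := fv (F v) j (leq_maxr _ _).
  by rewrite /F' -E' /F -E autK.
have F'K : cancel F' F.
  move=> v; pose j := maxn (N v) (N (F' v)).
  have [_ E] := fv v j (leq_maxl _ _); have [E' _] := fv (F' v) j (leq_maxr _ _).
  by rewrite /F -E' /F' -E autKV.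
have bijF : `[< bijective F >] by apply/asboolP; exists F'.
have autF : Permutation bijF \in aut_pred (R := R).
  apply/asboolP => u v uv; pose j := maxn (N u) (N v).
  have [Eu _] := fv u j (leq_maxl _ _); have [Ev _] := fv v j (leq_maxr _ _).
  by rewrite /= /F -Eu -Ev aut_colour.
exists (AutEC autF) => n; apply/aut_codeP => i v ni iv.
have [E E'] : f n v = F v /\ (f n)^-1 v = F' v.
  pose j := maxn n (N v); have [E E'] := fv v j (leq_maxr _ _).
  have /aut_codeP/(_ i v ni iv)[E1 E2] := fle n j (leq_maxl _ _).
  by rewrite -E1 -E2 E E'.
rewrite E E'; split=> //; apply: (can_inj (autK (AutEC autF))).
by rewrite autKV /= F'K.
Qed.

Lemma aut_code_mulr n h : exists j : nat, forall g g',
  aut_code j g = aut_code j g' -> aut_code n (g * h) = aut_code n (g' * h).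
Proof.
have [s sP] := aut_code_agree n; have [j jP] := agree_aut_code (s ++ map h^-1 s).
exists j => g g' /jP {}jP.
apply: sP => v vs; rewrite !invgM !autM.
have [-> _] : g v = g' v /\ g^-1 v = g'^-1 v by apply: jP; rewrite mem_cat vs.
have [_ ->] // : g (h^-1 v) = g' (h^-1 v) /\ g^-1 (h^-1 v) = g'^-1 (h^-1 v).
by apply: jP; rewrite mem_cat map_f ?orbT.
Qed.

(** Right translation by [h] is a homeomorphism, with inverse the translation by [h^-1]. *)
Lemma meagre_mulr (A : G -> Prop) h :
  meagre aut_code A -> meagre aut_code (fun g => A (g * h)).
Proof.
move=> [F [Fn FA]]; exists (fun i g => F i (g * h)); split=> [k n g|g /FA//].
have [n' n'P] := aut_code_mulr n h^-1.
have [j [g' [n'j g'g jP]]] := Fn k n' (g * h).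
have [i iP] := aut_code_mulr j h.
exists (maxn n i), (g' * h^-1); split; first exact: leq_maxl.
  by have := n'P _ _ g'g; rewrite /ball mulgK.
move=> z zg; apply: jP; rewrite /ball -[g'](mulgKV h); apply: iP.
exact: (coding_le aut_coding) (leq_maxr _ _) zg.
Qed.

Lemma commute_conj_closed t a b :
  (forall s, exists a' b', [/\ agree s a' a, agree s b' b
    & commute (t ^ a') (t ^ b')]) -> commute (t ^ a) (t ^ b).
Proof.
move=> H; apply: aut_eq => v.
change ((t ^ b) ((t ^ a) v) = (t ^ a) ((t ^ b) v)).
have conjE s g g' u : agree s g' g -> u \in s -> t (g^-1 u) \in s ->
    (t ^ g') u = (t ^ g) u.
  move=> gg us tus; rewrite !autJ; have [_ ->] := gg u us.
  by have [-> _] := gg _ tus.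
pose p := (t ^ a) v; pose q := (t ^ b) v.
(* The listed points are those at which [a], [b] or their inverses are evaluated when both products
   are computed at [v]. *)
have [a' [b' [aa bb ab]]] := H [:: v; p; q; t (a^-1 v); t (b^-1 v);
  t (b^-1 p); t (a^-1 q)].
have : (t ^ b') ((t ^ a') v) = (t ^ a') ((t ^ b') v).
  by rewrite -(autM (t ^ a')) ab.
rewrite (conjE _ _ _ v aa) ?inE ?eqxx ?orbT //.
rewrite (conjE _ _ _ v bb) ?inE ?eqxx ?orbT //.
rewrite (conjE _ _ _ p bb) ?inE ?eqxx ?orbT //.
by rewrite (conjE _ _ _ q aa) ?inE ?eqxx ?orbT.
Qed.

Lemma commuting_path_closed t g a b c :
  (forall s, exists g' a' b' c', [/\ commuting_path t g' a' b' c',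
     agree s g' g, agree s a' a & agree s b' b /\ agree s c' c]) ->
  commuting_path t g a b c.
Proof.
move=> H; split; [rewrite -[t in commute t _]conjg1| | |];
  apply: commute_conj_closed => s;
  have [g' [a' [b' [c' [[h1 h2 h3 h4] gg aa [bb cc]]]]]] := H s.
- by exists 1, a'; split; rewrite ?conjg1.
- by exists a', b'.
- by exists b', c'.
- by exists c', g'.
Qed.

Definition aut_code3 n (w : G * G * G) :=
  (aut_code n w.1.1, aut_code n w.1.2, aut_code n w.2).

(* Automatic continuity: [A] is analytic and, having countable index, not
   meagre; so it is comeagre in some ball, and this makes it open. *)
Theorem countable_index_open (A : G -> Prop) (t : G) (r : R -> G) :
  (forall g h, A g -> A h -> A (g^-1 * h)) ->
  (forall g, A g <-> exists a b c, commuting_path t g a b c) ->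
  (forall g, exists x, A (g * r x)) ->
  exists s, forall g, pointwise_stabiliser s g -> A g.
Proof.
move=> AG AP Ar.
pose Z g (w : G * G * G) := commuting_path t g w.1.1 w.1.2 w.2.
have AE g : A g <-> exists w, Z g w.
  rewrite AP; split=> [[a [b [c abc]]]|[[[a b] c] abc]]; first by exists (a, b, c).
  by exists a, b, c.
have code3 (n : nat) (w w' : G * G * G) : aut_code3 n w = aut_code3 n w' ->
    [/\ aut_code n w.1.1 = aut_code n w'.1.1, aut_code n w.1.2 = aut_code n w'.1.2
      & aut_code n w.2 = aut_code n w'.2] by case.
have coding3 : coding aut_code3.
  by move=> n w w' /code3[/aut_coding E1 /aut_coding E2 /aut_coding E3]; congr (_, _, _).
have complete3 : complete aut_code3.
  move=> f fS.
  have [a aP] := aut_complete (u := fun n => (f n).1.1)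
    (fun n => let: And3 E _ _ := code3 _ _ _ (fS n) in E).
  have [b bP] := aut_complete (u := fun n => (f n).1.2)
    (fun n => let: And3 _ E _ := code3 _ _ _ (fS n) in E).
  have [c cP] := aut_complete (u := fun n => (f n).2)
    (fun n => let: And3 _ _ E := code3 _ _ _ (fS n) in E).
  by exists (a, b, c) => n; congr (_, _, _); [apply: aP|apply: bP|apply: cP].
have Zc g w : (forall n, exists g' w', [/\ Z g' w', aut_code n g' = aut_code n g
    & aut_code3 n w' = aut_code3 n w]) -> Z g w.
  case: w => [[a b] c] H; apply: commuting_path_closed => s.
  have [n nP] := agree_aut_code s.
  have [g' [[[a' b'] c'] [Zw gg /code3[/= aa bb cc]]]] := H n.
  by exists g', a', b', c'; split; [|apply: nP|apply: nP|split; apply: nP].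
(* Right translates of [A], indexed by the countable set of vertices, cover the group. *)
have nm : ~ meagre aut_code (fun g => exists w, Z g w).
  move=> mA; apply: (baire aut_coding aut_complete (n := 0) (x := 1)).
  apply: (@meagre_sub _ _ _ _ (fun g => exists x, A (g * r x))) => [g _|]; first exact: Ar.
  apply: (meagre_bigcup (A := fun x g => A (g * r x))) => x.
  by apply: meagre_mulr; apply: meagre_sub mA => g /AE.
have [n [g mg]] := analytic_comeagre aut_coding coding3 complete3 Zc nm.
pose s : seq R := pmap choice.unpickle (iota 0 n).
exists (s ++ map g s) => h hs.
have ballh y : ball aut_code n g y -> ball aut_code n g (y * h).
  move=> /aut_codeP yg; apply/aut_codeP => i v ni iv; have [E E'] := yg i v ni iv.
  have vs : v \in s by rewrite mem_pmap -iv map_f // mem_iota.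
  rewrite invgM !autM E hs ?mem_cat ?map_f ?orbT //; split=> //.
  by rewrite -E' -{1}(hs v) ?autK // mem_cat vs.
(* For [y] in the ball off a meagre set, both [y] and [y * h] are in [A], and so is their quotient
   [h]; without [A h] the whole ball would be meagre. *)
apply: contrapT => nAh; apply: (baire aut_coding aut_complete (n := n) (x := g)).
have mg' := meagreU mg (meagre_mulr h mg).
apply: meagre_sub mg' => y yg; case: (pselect (A y)) => Ay; last first.
  by left; split=> // /AE.
right; split; first exact: ballh.
by move=> /AE Ayh; apply: nAh; rewrite -[h](mulKg y); apply: AG.
Qed.

End AutomorphismSpace.

(** * Open subgroups and their supports *)

Section OpenSubgroups.
Variables (m : nat) (R : ecgraph m) (c0 : 'I_m).
Hypothesis EP : extension_property R.
Implicit Types (u v w x y z : R) (p q : seq (R * R)).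
Notation G := (Aut_ec R).
Implicit Types g h k : G.

(** The identity on [B] is extended to [Y] one point at a time. The colours demanded by [p] and by
    [F] do not clash, because all images lie in [B] or off [Z]. *)
Lemma fresh_copy (B Y Z : seq R) (F : R -> R -> 'I_m) : exists g : G,
  pointwise_stabiliser B g /\
  forall y, y \in Y -> y \notin B -> [/\ g y \notin B, g y \notin Z
    & forall z, z \in Z -> z \notin B -> colour (g y) z = F y z].
Proof.
pose fresh y w := [/\ w \notin B, w \notin Z
  & forall z, z \in Z -> z \notin B -> colour w z = F y z].
pose good p := [/\ partial_iso p, forall b, b \in B -> (b, b) \in p
  & forall u w, (u, w) \in p -> u \in B /\ w = u \/ fresh u w].
suff [p [[pi pB pF] pY]] : exists p, good p /\ {subset Y <= unzip1 p}.
  have [g gP] := homogeneous_list c0 EP pi; exists g; split=> [b bB|y yY yB].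
    exact: gP (pB _ bB).
  have /mem_domP[w yw] := pY y yY; have /= -> := gP _ yw.
  by have [[]|] := pF _ _ yw; first by rewrite (negPf yB).
elim: Y => [|y Y [p [pG pY]]].
  exists [seq (b, b) | b <- B]; split=> //; split.
  - by move=> _ _ /mapP[b _ ->] /mapP[b' _ ->]; apply: compat_id.
  - by move=> b bB; apply/mapP; exists b.
  - by move=> u w /mapP[b bB [-> ->]]; left.
have [yp|yp] := boolP (y \in unzip1 p).
  by exists p; split=> // u; rewrite inE => /predU1P[->|/pY].
have [pi pB pF] := pG.
have [w] := EP (unzip2 p ++ B ++ Z)
  (fun u => if u \in unzip2 p then colour y (lookup (flip p) u) else F y u).
rewrite !mem_cat !negb_or => /and3P[wp wB wZ] wP.
exists ((y, w) :: p); split; last first.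
  by move=> u; rewrite /= !inE => /predU1P[->|/pY->]; rewrite ?eqxx ?orbT.
split.
- apply: partial_iso_cons => // -[u u'] uu'; apply: compat_neq.
  + by apply: contraNneq yp => ->; apply: mem_dom uu'.
  + by apply: contraNneq wp => ->; apply: mem_rng uu'.
  + rewrite wP ?mem_cat ?(mem_rng uu') // (lookupE (v := u)) ?mem_flip //.
    exact: partial_iso_flip.
- by move=> b bB; rewrite inE pB ?orbT.
- move=> u u'; rewrite inE => /predU1P[[-> ->]|/pF//]; right; split=> // z zZ zB.
  rewrite wP ?mem_cat ?zZ ?orbT // ifN //; apply/negP => /mem_rngP[z' /pF].
  by case=> [[z'B E]|[_]]; [rewrite E z'B in zB|rewrite zZ].
Qed.

Lemma stabiliser_inj x y : (forall g, g x = x -> g y = y) -> x = y.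
Proof.
move=> xy; have [g [gx gy]] := fresh_copy [:: x] [:: y] [:: y] (fun _ _ => c0).
apply/eqP; apply: contraTT isT => nxy.
have [||_] := gy y; rewrite ?inE // 1?eq_sym //.
by rewrite xy ?eqxx //; apply: gx; rewrite inE.
Qed.

Definition is_subgroup (H : G -> Prop) :=
  H 1 /\ forall g h, H g -> H h -> H (g^-1 * h).

Lemma subgroupV H g : is_subgroup H -> H g -> H g^-1.
Proof. by case=> H1 HM Hg; rewrite -[g^-1]mulg1; apply: HM. Qed.

Lemma subgroupM H g h : is_subgroup H -> H g -> H h -> H (g * h).
Proof.
by move=> HG Hg Hh; rewrite -[g]invgK; apply: HG.2 => //; apply: subgroupV.
Qed.

Definition supports (A : seq R) (H : G -> Prop) :=
  forall g, pointwise_stabiliser A g -> H g.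

Lemma supports_conj A H h : is_subgroup H -> supports A H -> H h ->
  supports (map h A) H.
Proof.
move=> HG AH Hh g gA; have -> : g = h^-1 * ((h * g * h^-1) * h).
  by rewrite !mulgA mulVg mul1g mulgKV.
apply: HG.2 => //; apply: subgroupM => //; apply: AH => a aA.
by rewrite !autM gA ?map_f // autK.
Qed.

(* Neumann's lemma and homogeneity make the stabilisers of [A] and [B] generate
   that of their intersection [C]: given [h] fixing [C], move [A] by [g] and
   then by [g'], both fixing [B], so that the partial map [g a |-> h a] extends
   by the identity on the copy [g' A]. *)
Lemma supports_inter H (A B : seq R) : is_subgroup H -> supports A H ->
  supports B H -> supports [seq a <- A | a \in B] H.
Proof.
move=> HG AH BH h hC.
have [g [gB gA]] := fresh_copy B A (A ++ map h A) (fun _ _ => c0).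
(* [g' b] must have the same colour towards [g a] and towards [h a]. If [h a] is in [B], then [g']
   fixes it and this is the colour of [b] and [h a]; otherwise the colour is free and set to
   [c0]. *)
pose F a z := if (z \in map g A) && (h (g^-1 z) \in B)
  then colour a (h (g^-1 z)) else c0.
have [g' [g'B g'A]] := fresh_copy B A (map g A ++ map h A) F.
have hB a : a \in A -> a \in B -> h a = a.
  by move=> aA aB; apply: hC; rewrite mem_filter aB.
pose p := [seq (g a, h a) | a <- A] ++ [seq (g' a, g' a) | a <- A].
have pi : partial_iso p.
  apply: partial_iso_cat.
  - move=> _ _ /mapP[a _ ->] /mapP[b _ ->].
    by have := compat_act g h (compat_id a b).
  - by move=> _ _ /mapP[a _ ->] /mapP[b _ ->]; apply: compat_id.
  move=> _ _ /mapP[a aA ->] /mapP[b bA ->].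
  have [aB|aB] := boolP (a \in B).
    by rewrite gB // hB //; apply: compat_id.
  have [bB|bB] := boolP (b \in B).
    rewrite g'B // -{1}[b](gB b) // -{2}[b](hB b) //.
    by have := compat_act g h (compat_id a b).
  have [gaB gaZ _] := gA a aA aB; have [g'bB g'bZ g'bc] := g'A b bA bB.
  move: g'bZ; rewrite mem_cat negb_or => /andP[g'bg g'bh].
  apply: compat_neq.
  - by apply: contraNneq g'bg => <-; apply: map_f.
  - by apply: contraNneq g'bh => <-; apply: map_f.
  have n1 : g a != g' b by apply: contraNneq g'bg => <-; apply: map_f.
  have n2 : h a != g' b by apply: contraNneq g'bh => <-; apply: map_f.
  rewrite colour_sym // [RHS]colour_sym //.
  rewrite [RHS]g'bc ?mem_cat ?map_f // /F map_f // autK andTb.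
  have [haB|haB] := boolP (h a \in B).
    by rewrite -{1}(g'B _ haB) aut_colour //; apply: contraNneq bB => ->.
  rewrite g'bc ?mem_cat ?map_f ?orbT // /F.
  (* [h a] cannot be some [g c]: for [c] in [B] it would be in [B], and otherwise [g c] avoids the
     image of [A] under [h]. *)
  case: ifP => // /andP[/mapP[c cA hac] _]; move: gA => /(_ c cA).
  have [cB|cB] := boolP (c \in B); first by move: haB; rewrite hac gB ?cB.
  by case=> // _; rewrite mem_cat negb_or -hac map_f ?andbF.
have [k kP] := homogeneous_list c0 EP pi.
have kg a : a \in A -> k (g a) = h a.
  by move=> aA; apply: (kP (g a, h a)); rewrite mem_cat map_f.
(* [k] fixes the copy of [A] under [g'], which supports [H] because [g'] is in [H]. Afterwards
   [g * k * h^-1] fixes [A], which brings [h] into [H]. *)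
have Hk : H k.
  have Hg' : H g' by apply: BH.
  apply: (supports_conj HG AH Hg') => _ /mapP[a aA ->].
  by apply: (kP (g' a, g' a)); rewrite mem_cat map_f ?orbT.
have Hgk : H (g * k) by apply: subgroupM => //; apply: BH.
have Hgkh : H (g * k * h^-1).
  by apply: AH => a aA; rewrite !autM kg // autK.
by have := HG.2 _ _ Hgkh Hgk; rewrite invgM invgK mulgKV.
Qed.

Theorem open_subgroup_point (H : G -> Prop) (s : seq R) : is_subgroup H ->
  supports s H -> (exists g, ~ H g) ->
  (forall gs : seq G, (forall g, g \in gs -> ~ H g) ->
     exists v : G, ~ H v /\ forall g, g \in gs -> H (g * v * g^-1)) ->
  exists x, forall g, H g <-> g x = x.
Proof.
move=> HG sH [g0 Hg0] meet.
pose P n := `[< exists2 A : seq R, size A = n & supports A H >].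
have exP : exists n, P n by exists (size s); apply/asboolP; exists s.
case: (ex_minnP exP) => n /asboolP[A An AH] Amin.
(* [A] and its image under [h] both support [H], hence so does their intersection, which by
   minimality is all of [A]. *)
have stab' h a : H h -> a \in A -> h^-1 a \in A.
  move=> Hh aA; have := supports_inter HG AH (supports_conj HG AH Hh).
  move=> H'; have /Amin : P (size [seq a <- A | a \in map h A]).
    by apply/asboolP; exists [seq a <- A | a \in map h A].
  rewrite -An size_filter => le; have : all (mem (map h A)) A.
    by rewrite all_count eqn_leq count_size.
  by move=> /allP/(_ a aA)/mapP[b bA ->]; rewrite autK.
have stab h a : H h -> a \in A -> h a \in A.
  by move=> Hh aA; rewrite -[h]invgK; apply: stab' => //; apply: subgroupV.
case: (pselect (exists2 a, a \in A & forall b, b \in A -> b = a)) => [[a aA A1]|nA].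
  exists a => g; split=> [Hg|ga]; first by apply/A1/stab.
  by apply: AH => b /A1->.
have other d : d \in A -> exists2 b, b \in A & b != d.
  move=> dA; apply: contrapT => nb; apply: nA; exists d => // b bA.
  by apply/eqP; apply: contrapT => /negP bd; apply: nb; exists b.
(* The images of [A] under the two elements meet only in [d]. An element of both conjugates of [H]
   maps [d] into each image, so it fixes [d]. *)
have moves d : d \in A -> exists gg : G * G, [/\ ~ H gg.1, ~ H gg.2,
    gg.1 d = d, gg.2 d = d & forall a, a \in A -> a != d -> gg.2 a \notin map gg.1 A].
  move=> dA; have [b bA bd] := other d dA.
  have [g1 [g1d g1A]] := fresh_copy [:: d] A A (fun _ _ => c0).
  have [g2 [g2d g2A]] := fresh_copy [:: d] A (A ++ map g1 A) (fun _ _ => c0).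
  exists (g1, g2); split=> /=.
  - move=> /stab/(_ bA); apply/negP.
    by have [|_ ? _] := g1A b bA; rewrite ?inE.
  - move=> /stab/(_ bA); apply/negP.
    have [|_ + _] := g2A b bA; rewrite ?inE //.
    by rewrite mem_cat negb_or => /andP[].
  - by apply: g1d; rewrite inE.
  - by apply: g2d; rewrite inE.
  - move=> a aA ad; have [|_ + _] := g2A a aA; rewrite ?inE //.
    by rewrite mem_cat negb_or => /andP[].
have [gg ggP] := choice_in (1 : G, 1 : G) moves.
have [|v [Hv vP]] := meet ([seq (gg d).1 | d <- A] ++ [seq (gg d).2 | d <- A]).
  by move=> g; rewrite mem_cat => /orP[]/mapP[d /ggP[? ? _ _ _] ->].
case: Hv; apply: AH => d dA; have [_ _ g1d g2d g12] := ggP d dA.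
have vd (g : G) : H (g * v * g^-1) -> g d = d -> exists2 a, a \in A & v d = g a.
  move=> /stab/(_ dA); rewrite !autM => + gd; rewrite gd => aA.
  by exists (g^-1 (v d)); rewrite // autKV.
have [|a aA va] := vd (gg d).1 _ g1d.
  by apply: vP; rewrite mem_cat (map_f (fun d => (gg d).1)).
have [|b bA vb] := vd (gg d).2 _ g2d.
  by apply: vP; rewrite mem_cat (map_f (fun d => (gg d).2)) ?orbT.
rewrite vb; have [->//|bd] := eqVneq b d.
by have := g12 b bA bd; rewrite -vb va map_f.
Qed.

End OpenSubgroups.

(** * The action of [Aut_star] by conjugation *)

Section Conjugation.
Variables (m : nat) (R : ecgraph m).
Notation G := (Aut_ec R).
Implicit Types (g h : Aut_star R) (a b : G).

(** The colour permutations of [g^-1] and [g] cancel, since [a] in between preserves colours. *)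
Fact conj_aut_subproof g a : aut_val a ^ aut_star_val g \in aut_pred (R := R).
Proof.
have /asboolP[pi gP] := aut_starP g; apply/asboolP => u v uv.
have gV w : aut_star_val g ((aut_star_val g)^-1 w) = w by apply: permutationKV.
have gI : injective (aut_star_val g) by exact: can_inj (permutationK _).
change (colour (g (a ((aut_star_val g)^-1 u))) (g (a ((aut_star_val g)^-1 v))) = colour u v).
rewrite -[in RHS](gV u) -[in RHS](gV v).
have uv' : (aut_star_val g)^-1 u != (aut_star_val g)^-1 v.
  by apply: contra uv => /eqP E; rewrite -(gV u) E gV.
by rewrite !gP ?(inj_eq (@aut_inj _ _ a)) // aut_colour.
Qed.

Definition conj_aut g a : G := AutEC (conj_aut_subproof g a).

Lemma conj_autM g h a : conj_aut (g * h) a = conj_aut h (conj_aut g a).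
Proof. by apply: val_inj; rewrite /= conjgM. Qed.

Lemma conj_aut1 a : conj_aut 1 a = a.
Proof. by apply: val_inj; rewrite /= conjg1. Qed.

Fact conj_aut_bij g : `[< bijective (conj_aut g) >].
Proof.
apply/asboolP; exists (conj_aut g^-1) => a; rewrite -conj_autM.
  by rewrite mulgV conj_aut1.
by rewrite mulVg conj_aut1.
Qed.

Fact conj_aut_morph g : Permutation (conj_aut_bij g) \in group_aut_pred (G := G).
Proof. by apply/asboolP => a b; apply: val_inj; rewrite /= conjMg. Qed.

Definition conj_group_aut g : group_aut G := GroupAut (conj_aut_morph g).

Fact conj_group_autM : {morph conj_group_aut : g h / g * h}.
Proof.
move=> g h; apply/val_inj/permutationP => a.
exact: conj_autM.
Qed.

HB.instance Definition _ :=
  isMultiplicative.Build (Aut_star R) (group_aut G) conj_group_aut conj_group_autM.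

End Conjugation.

(** * Automorphisms of the automorphism group *)

Section AutomorphismsOfAut.
Variables (m : nat) (R : ecgraph m) (c0 : 'I_m).
Hypothesis EP : extension_property R.
Notation G := (Aut_ec R).
Implicit Types (u v x y : R) (a b g h t : G).

Lemma commuting_path_morph (f : G -> G) t g a b c : {morph f : g h / g * h} ->
  commuting_path t g a b c -> commuting_path (f t) (f g) (f a) (f b) (f c).
Proof.
move=> fM.
have f1 : f 1 = 1 by apply: (mulgI (f 1)); rewrite -fM !mulg1.
have fV g' : f g'^-1 = (f g')^-1.
  by apply: (mulgI (f g')); rewrite -fM !mulgV.
have fJ g' h : f g' ^ f h = f (g' ^ h) by rewrite /conjg !fM fV.
have fC g' h : commute g' h -> commute (f g') (f h) by rewrite /commute -!fM => ->.
by case=> *; split; rewrite !fJ; apply: fC.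
Qed.

Lemma transitive_pair u v u' v' : u != v -> u' != v' ->
  colour u' v' = colour u v -> exists a : G, a u = u' /\ a v = v'.
Proof.
move=> uv u'v' C; have [|a aP] := @homogeneous_list _ _ c0 EP [:: (u, u'); (v, v')].
  apply: partial_iso_cons => [e f|f]; rewrite !inE => /eqP->.
    by move=> /eqP->; apply: compat_refl.
  exact: compat_neq.
by exists a; split; [apply: (aP (u, u'))|apply: (aP (v, v'))]; rewrite !inE eqxx ?orbT.
Qed.

Lemma transitive_point x y : exists a : G, a x = y.
Proof.
have [|a aP] := @homogeneous_list _ _ c0 EP [:: (x, y)].
  by move=> e f; rewrite !inE => /eqP-> /eqP->; apply: compat_refl.
by exists a; apply: (aP (x, y)); rewrite inE.
Qed.

(** The image [H] of the stabiliser is given by the same existential formula with parameter [f t],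
    so automatic continuity makes it open. *)
Lemma image_stabiliser (f f' : G -> G) x : cancel f f' -> cancel f' f ->
  {morph f : g h / g * h} ->
  exists y, forall g, f g y = y <-> g x = x.
Proof.
move=> fK f'K fM.
have f'M : {morph f' : g h / g * h}.
  by move=> g h; apply: (can_inj fK); rewrite fM !f'K.
have [t tP] := pointed_involution_exists c0 EP x.
pose H g := f' g x = x.
have f'1 : f' 1 = 1 by apply: (mulgI (f' 1)); rewrite -f'M !mulg1.
have f'V g : f' g^-1 = (f' g)^-1.
  by apply: (mulgI (f' g)); rewrite -f'M !mulgV.
have HG : is_subgroup H.
  split=> [|g h gx hx]; first by rewrite /H f'1.
  by rewrite /H f'M f'V autM -{1}gx autK.
have HP g : H g <-> exists a b c, commuting_path (f t) g a b c.
  rewrite /H (stabiliserP EP _ tP); split=> -[a [b [c]]] abc.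
    by exists (f a), (f b), (f c); rewrite -[g]f'K; apply: commuting_path_morph.
  exists (f' a), (f' b), (f' c); rewrite -[t]fK.
  exact: commuting_path_morph f'M abc.
(* The elements [f (r y)] represent all cosets of [H]; for [g], the vertex [y] is [f' g x]. *)
have /choice[r rP] : forall y, exists a : G, a y = x by move=> y; apply: transitive_point.
have [|s sH] := countable_index_open (r := fun y => f (r y)) HG.2 HP.
  by move=> g; exists (f' g x); rewrite /H f'M fK autM rP.
have [|gs gsP|y yP] := open_subgroup_point c0 EP HG sH.
- have [g [_ gx]] := fresh_copy c0 EP [::] [:: x] [:: x] (fun _ _ => c0).
  exists (f g); rewrite /H fK => E.
  by have [||_] := gx x; rewrite ?inE // E eqxx.
(* The vertices [f' g x] differ from [x], so some [v] fixes all of them and moves [x]; [f v] lies in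
   the conjugates but not in [H]. *)
- have [v [vB vx]] := fresh_copy c0 EP [seq f' g x | g <- gs] [:: x] [:: x]
    (fun _ _ => c0).
  exists (f v); split=> [|g ggs]; rewrite /H.
    rewrite fK => E; have [||_] := vx x; rewrite ?inE // ?E ?eqxx //.
    by apply/mapP => -[g /gsP gH gx]; apply: gH; rewrite /H -gx.
  by rewrite !f'M f'V fK !autM vB ?autK // (map_f (fun g => f' g x)).
by exists y => g; rewrite -yP /H fK.
Qed.

Lemma group_aut_conj (f : group_aut G) : exists g : Aut_star R,
  forall a, aut_val (f a) = aut_val a ^ aut_star_val g.
Proof.
pose f' : G -> G := (group_aut_val f)^-1.
have fK : cancel f f' := permutationK _.
have f'K : cancel f' f := permutationKV _.
have fM : {morph f : g h / g * h} by have /asboolP := group_autP f.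
have f'M : {morph f' : g h / g * h}.
  by move=> g h; apply: (can_inj fK); rewrite fM !f'K.
(* [k x] is the vertex whose stabiliser is the image of that of [x]. Since stabilisers determine
   vertices, identities about [k] are proved by comparing stabilisers. *)
have /choice[k kP] : forall x, exists y, forall g, f g y = y <-> g x = x.
  by move=> x; apply: image_stabiliser fK f'K fM.
have /choice[k' k'P] : forall x, exists y, forall g, f' g y = y <-> g x = x.
  by move=> x; apply: image_stabiliser f'K fK f'M.
have stab_eq x y : (forall g, g x = x <-> g y = y) -> x = y.
  by move=> xy; apply: (stabiliser_inj c0 EP) => g /xy.
have k'K : cancel k' k.
  by move=> y; apply: stab_eq => g; rewrite -{1}[g]f'K kP k'P.
have kK : cancel k k'.
  by move=> y; apply: stab_eq => g; rewrite -{1}[g]fK k'P kP.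
have kE a x : k (a x) = f a (k x).
  apply: stab_eq => g; rewrite -[g]f'K kP.
  have E b h z : b (h z) = h z <-> (h * b * h^-1) z = z.
    rewrite !autM; split=> [->|E]; first by rewrite autK.
    by rewrite -{2}E autKV.
  rewrite !E -kP !fM.
  have -> // : f a^-1 = (f a)^-1.
  by apply: (mulgI (f a)); rewrite -fM !mulgV; apply: (mulgI (f 1)); rewrite -fM !mulg1.
have kI : injective k := can_inj kK.
have kN u v : u != v -> k u != k v by apply: contra => /eqP/kI->.
have /choice[col colP] : forall i : 'I_m, exists e : R * R,
    e.1 != e.2 /\ colour e.1 e.2 = i.
  move=> i; have [u _ _] := EP [::] (fun _ => i).
  have [v vu vi] := EP [:: u] (fun _ => i); rewrite inE in vu.
  by exists (v, u); rewrite vi ?inE.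
(* Pairs of a given colour form one orbit, so the colour of the image under [k] does not depend on
   the representative [col i]. *)
pose pi i := colour (k (col i).1) (k (col i).2).
have piP i u v : u != v -> colour u v = i -> colour (k u) (k v) = pi i.
  move=> uv c; have [ni ci] := colP i; rewrite -ci in c.
  have [a [<- <-]] := transitive_pair ni uv c.
  by rewrite !kE aut_colour //; apply: kN.
(* An element joining two image pairs of equal colour is pulled back through [f'] to one joining the
   original pairs. *)
have pi_inj : injective pi.
  move=> i j ij; have [ni ci] := colP i; have [nj cj] := colP j.
  have [|||b [b1 b2]] := @transitive_pair (k (col i).1) (k (col i).2) (k (col j).1) (k (col j).2).
  - exact: kN.
  - exact: kN.
  - exact: esym.
  rewrite -[b]f'K -!kE in b1 b2.
  by rewrite -ci -cj -(kI _ _ b1) -(kI _ _ b2) aut_colour.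
have kbij : `[< bijective k >] by apply/asboolP; exists k'.
have kstar : Permutation kbij \in aut_star_pred (R := R).
  by apply/asboolP; exists (perm pi_inj) => u v uv; rewrite permE; apply: piP.
exists (AutStar kstar) => a; apply: permutationP => y.
have -> : y = k (k' y) by rewrite k'K.
rewrite -kE; change (k (a (k' y)) = k (a ((Permutation kbij)^-1 (k (k' y))))).
by rewrite (permutationK (Permutation kbij)).
Qed.

(** Conjugation by [g] carries the stabiliser of [u] to that of [g u], which determines [g u]. *)
Lemma conj_group_aut_inj : injective (@conj_group_aut m R).
Proof.
move=> g h gh; apply/val_inj/permutationP => u.
have gh' a : aut_val a ^ aut_star_val g = aut_val a ^ aut_star_val h.
  by have := congr1 (fun f : group_aut G => aut_val (f a)) gh.
apply: (can_inj (permutationK (aut_star_val h)^-1)).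
rewrite permutationK; apply: esym.
apply: (stabiliser_inj c0 EP) => a au.
have : (aut_val a ^ aut_star_val h) (g u) = g u.
  rewrite -gh'; change (g (a ((aut_star_val g)^-1 (g u))) = g u).
  by rewrite permutationK au.
change (h (a ((aut_star_val h)^-1 (g u))) = g u ->
  a ((aut_star_val h)^-1 (g u)) = (aut_star_val h)^-1 (g u)).
by move=> {2}<-; rewrite permutationK.
Qed.

End AutomorphismsOfAut.

Theorem theorem2 (m : nat) (hm : (2 <= m)%N) (R : ecgraph m)
    (R_universal : universal R) (R_homogeneous : homogeneous R) :
  exists phi : {multiplicative Aut_star R -> group_aut (Aut_ec R)},
    (forall (g : Aut_star R) (a : Aut_ec R),
       aut_val (phi g a) = (aut_val a ^ aut_star_val g)%g) /\
    bijective phi.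
Proof.
have c0 : 'I_m by apply: Ordinal (ltnW hm).
have EP := universal_homogeneous_extension c0 R_universal R_homogeneous.
exists (@conj_group_aut m R); split=> //.
have /choice[psi psiP] : forall f, exists g, conj_group_aut (R := R) g = f.
  move=> f; have [g gP] := group_aut_conj c0 EP f; exists g.
  apply/val_inj/permutationP => a; apply: val_inj; exact: esym (gP a).
exists psi => [g|//]; apply: (conj_group_aut_inj c0 EP).
exact: psiP.
Qed.
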